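(* Let $n\geq 3$, let $\pi$ be a triangulation of the regular $n$-gon $\mathcal{P}_n$, and let $U(\pi)=(u_{ij})$ be the symmetric $n\times n$ matrix of cluster variables and stable variables (with $u_{ii}=0$) of the cluster algebra $\mathcal{A}$ of type $A_{n-3}$ associated to $\mathcal{P}_n$, regarded as Laurent polynomials in the $u_{ij}$ for $i,j$ end-points of diagonals in $\pi$ with coefficients given by polynomials in the stable variables. Then $$\sum_{C}\varepsilon(C)\,\alpha(C)=-(-2)^{n-2}\,u_{12}u_{23}\cdots u_{n-1,n}u_{n,1},$$ where the sum is over all frame-free configurations $C$ of the root category $\mathcal{R}_n=D^b(kQ)/[2]$ of maximum cardinality.
   Context: Polygon and cluster variables. $\mathcal{P}_n$ is a regular $n$-sided polygon with vertices $1,\ldots,n$ numbered clockwise around the boundary (modulo $n$). Given a triangulation $\pi$ (maximal set of pairwise non-crossing diagonals), let $\mathbb{F}$ be the field of rational functions over $\mathbb{C}$ in independent variables $u_{ij}=u_{ji}$, one for each pair of end-points of a diagonal in $\pi$ or of a boundary edge. For an arbitrary diagonal with end-points $j,l$, elements $u_{jl}=u_{lj}\in\mathbb{F}$ are defined inductively: if $i,j,k,l$ are arranged clockwise and $u_{ij},u_{jk},u_{kl},u_{li},u_{ik}$ are defined but $u_{jl}$ is not, then $u_{jl}$ is defined by $u_{ij}u_{kl}+u_{jk}u_{il}=u_{ik}u_{jl}$. These elements are known to be well-defined and to satisfy this relation for all clockwise $i,j,k,l$. Set $u_{ii}=0$. $\mathcal{A}$ is the $\mathbb{C}$-subalgebra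 of $\mathbb{F}$ generated by the $u_{ij}$; the $u_{ij}$ for boundary edges are called stable variables, those for diagonals cluster variables. Root category. Let $k$ be an algebraically closed field, $Q$ a quiver of type $A_{n-1}$, $D^b(kQ)$ the bounded derived category of (finite-dimensional) $kQ$-modules with shift $[1]$, and $\mathcal{R}_n=D^b(kQ)/[2]$ the orbit category (so $\operatorname{Hom}_{\mathcal{R}_n}(X,Y)=\bigoplus_{m\in\mathbb{Z}}\operatorname{Hom}_{D^b(kQ)}(X,Y[2m])$ and $X\cong X[2]$). It is a triangulated category, and $\operatorname{Ext}^1_{\mathcal{R}_n}(X,Y)=\operatorname{Hom}_{\mathcal{R}_n}(X,Y[1])$. Up to equivalence it does not depend on the orientation of $Q$; take $Q$ linearly oriented with arrows $i\leftarrow i+1$, $1\leq i\leq n-2$. For $1\leq i<j\leq n$ let $M_{ij}$ be the indecomposable $kQ$-module with socle the simple module $S_i$ at vertex $i$ and length $j-i$, and for $i<j$ set $M_{ji}=M_{ij}[1]$. Then $[i,j]\mapsto M_{ij}$ is a bijection from the set of oriented edges $[i,j]$ (from $i$ to $j$, $i\neq j$, boundary edges included) between vertices of $\mathcal{P}_n$ to the set $\operatorname{ind}(\mathcal{R}_n)$ of isomorphism classes of indecomposable objects of $\mathcal{R}_n$; objects and oriented edges are identified via this bijection. Frames. For $X\in\operatorname{ind}(\mathcal{R}_n)$ put $S(X)=\{Y\in\operatorname{ind}(\mathcal{R}_n):\operatorname{Hom}_{\mathcal{R}_n}(X,Y)\neq 0,\ \operatorname{Ext}^1_{\mathcal{R}_n}(Y,X)=0\}$,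 $E(X)=\{Y\in\operatorname{ind}(\mathcal{R}_n):\operatorname{Hom}_{\mathcal{R}_n}(Y,X)\neq 0,\ \operatorname{Ext}^1_{\mathcal{R}_n}(X,Y)=0\}$, and let the frame be $F(X)=S(X)\cup E(X)$. A frame-free configuration of $\mathcal{R}_n$ is a maximal (under inclusion) collection $C\subseteq\operatorname{ind}(\mathcal{R}_n)$ such that $Y\notin F(X)$ for all distinct $X,Y\in C$. The maximum cardinality of a frame-free configuration is $n$, and a frame-free configuration of cardinality $n$, viewed as a collection of oriented edges, is a union of disjoint oriented cycles (each with at least two vertices) covering all vertices of $\mathcal{P}_n$. Sign and weight. For a frame-free configuration $C$ of cardinality $n$, $\varepsilon(C)=\prod_{\gamma}(-1)^{\ell(\gamma)-1}$, the product over the oriented cycles $\gamma$ in $C$ with $\ell(\gamma)$ the number of vertices of $\gamma$; and $\alpha(C)=\prod_{[i,j]\in C}u_{ij}$. *)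

(* Defs.v *)
From HB Require Import structures.
From mathcomp Require Import all_boot all_order all_algebra.
From mathcomp Require Import boolp classical_sets reals.
From mathcomp Require Import complex mpoly.

Set Implicit Arguments.
Unset Strict Implicit.
Unset Printing Implicit Defensive.

Import Order.TTheory GRing.Theory Num.Theory.

Local Open Scope ring_scope.

(* The vertices 1, ..., n of the polygon are represented by 0, ..., n.-1 in
   'I_n, and unoriented edges by two-element sets of vertices.  The four
   arguments of clockwise are pairwise distinct. *)
Definition clockwise n (i j k l : 'I_n) : bool :=
  [|| (i < j < k)%N && (k < l)%N, (j < k < l)%N && (l < i)%N,
      (k < l < i)%N && (i < j)%N | (l < i < j)%N && (j < k)%N].

Definition boundary n : {set {set 'I_n}} := [set [set i; ordS i] | i : 'I_n].

Definition diagonal n (d : {set 'I_n}) : bool :=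
  (#|d| == 2%N) && (d \notin boundary n).

Definition crossing n (d e : {set 'I_n}) : bool :=
  [exists i, exists j, exists k, exists l,
    [&& clockwise i j k l, d == [set i; k] & e == [set j; l]]].

Definition noncrossing n (P : {set {set 'I_n}}) : bool :=
  [forall d in P, diagonal d]
  && [forall d in P, forall e in P, ~~ crossing d e].

Definition triangulation n (P : {set {set 'I_n}}) : bool :=
  maxset (@noncrossing n) P.

Section ClusterVariables.
Variables (R : realType) (n : nat) (P : {set {set 'I_n}}).

Definition initial_edges : {set {set 'I_n}} := P :|: boundary n.

(* Rational functions over the complex numbers R[i], with one variable for
   each initial edge; the variable of index x belongs to enum_val x. *)
Definition ratfun : fieldType :=
  {fraction {mpoly R[i][#|initial_edges|]}}.

Definition ratvar (x : 'I_#|initial_edges|) : ratfun :=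
  tofrac ('X_x : {mpoly R[i][#|initial_edges|]}).

(* cluster_value i j a : the element u_ij is defined by the exchange
   procedure, with value a. *)
Inductive cluster_value : 'I_n -> 'I_n -> ratfun -> Prop :=
| ClusterInitial x i j :
    enum_val x = [set i; j] -> cluster_value i j (ratvar x)
| ClusterSym i j a : cluster_value i j a -> cluster_value j i a
| ClusterExchange i j k l uij ujk ukl uli uik :
    clockwise i j k l ->
    cluster_value i j uij -> cluster_value j k ujk ->
    cluster_value k l ukl -> cluster_value l i uli ->
    cluster_value i k uik ->
    cluster_value j l ((uij * ukl + ujk * uli) / uik).

(* For a triangulation P and i != j there is exactly one value, which xget
   selects. *)
Definition cluster_matrix : 'M[ratfun]_n :=
  \matrix_(i, j)
    if i == j then 0 else xget 0 [set a | cluster_value i j a]%classic.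

End ClusterVariables.

Record quiver := Quiver {
  vertex : finType;
  arrow : finType;
  source : arrow -> vertex;
  target : arrow -> vertex }.

Section Representations.
Variables (k : fieldType) (Q : quiver).

(* Finite-dimensional modules over the path algebra, as representations by
   matrices acting on row vectors. *)
Record rep := Rep {
  dim : vertex Q -> nat;
  act : forall a : arrow Q, 'M[k]_(dim (source a), dim (target a)) }.

Record rep_hom (M N : rep) := RepHom {
  hom_mx :> forall v, 'M[k]_(dim M v, dim N v);
  hom_act : forall a,
    act M a *m hom_mx (target a) = hom_mx (source a) *m act N a }.

Definition rep0 : rep := @Rep (fun=> 0%N) (fun=> 0).

Fact hom0_act (M N : rep) a : act M a *m 0 = 0 *m act N a.
Proof. by rewrite mulmx0 mul0mx. Qed.
Definition hom0 (M N : rep) : rep_hom M N :=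
  @RepHom M N (fun=> 0) (@hom0_act M N).

Fact hom1_act (M : rep) a : act M a *m 1%:M = 1%:M *m act M a.
Proof. by rewrite mulmx1 mul1mx. Qed.
Definition hom1 (M : rep) : rep_hom M M :=
  @RepHom M M (fun=> 1%:M) (@hom1_act M).

Fact hom_comp_act (M N L : rep) (f : rep_hom M N) (g : rep_hom N L) a :
  act M a *m (f (target a) *m g (target a))
  = (f (source a) *m g (source a)) *m act L a.
Proof. by rewrite mulmxA hom_act -mulmxA hom_act mulmxA. Qed.
(* first f, then g *)
Definition hom_comp (M N L : rep) (f : rep_hom M N) (g : rep_hom N L) :
  rep_hom M L := @RepHom M L (fun v => f v *m g v) (hom_comp_act f g).

Fact hom_scale_act (M N : rep) (c : k) (f : rep_hom M N) a :
  act M a *m (c *: f (target a)) = (c *: f (source a)) *m act N a.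
Proof. by rewrite -scalemxAr hom_act scalemxAl. Qed.
Definition hom_scale (M N : rep) (c : k) (f : rep_hom M N) : rep_hom M N :=
  @RepHom M N (fun v => c *: f v) (hom_scale_act c f).

(* The differential is a family indexed by all pairs of degrees, which
   vanishes off the pairs (p, p + 1); this avoids transports between
   propositionally equal degrees. *)
Record bcomplex := BComplex {
  obj :> int -> rep;
  diff : forall p q, rep_hom (obj p) (obj q);
  diff_shape : forall p q v, q != p + 1 -> diff p q v = 0;
  diff_comp : forall p q r v, diff p q v *m diff q r v = 0;
  bounded : exists N : nat, forall p v, (N < `|p|)%N -> dim (obj p) v = 0%N }.

Record chain_map (X Y : bcomplex) := ChainMap {
  chain :> forall p, rep_hom (X p) (Y p);
  chain_comm : forall p q v,
    chain p v *m diff Y p q v = diff X p q v *m chain q v }.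

Fact chain0_comm (X Y : bcomplex) p q v :
  hom0 (X p) (Y p) v *m diff Y p q v = diff X p q v *m hom0 (X q) (Y q) v.
Proof. by rewrite /= mulmx0 mul0mx. Qed.
Definition chain0 (X Y : bcomplex) : chain_map X Y :=
  @ChainMap X Y (fun p => hom0 (X p) (Y p)) (@chain0_comm X Y).

Fact chain1_comm (X : bcomplex) p q v :
  hom1 (X p) v *m diff X p q v = diff X p q v *m hom1 (X q) v.
Proof. by rewrite /= mulmx1 mul1mx. Qed.
Definition chain1 (X : bcomplex) : chain_map X X :=
  @ChainMap X X (fun p => hom1 (X p)) (@chain1_comm X).

Fact chain_comp_comm (X Y Z : bcomplex) (f : chain_map X Y)
  (g : chain_map Y Z) p q v :
  hom_comp (f p) (g p) v *m diff Z p q v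
  = diff X p q v *m hom_comp (f q) (g q) v.
Proof. by rewrite /= -mulmxA chain_comm mulmxA chain_comm mulmxA. Qed.
(* first f, then g *)
Definition chain_comp (X Y Z : bcomplex) (f : chain_map X Y)
  (g : chain_map Y Z) : chain_map X Z :=
  @ChainMap X Z (fun p => hom_comp (f p) (g p)) (chain_comp_comm f g).

Definition homotopic (X Y : bcomplex) (f g : chain_map X Y) : Prop :=
  exists h : forall p q, rep_hom (X p) (Y q), forall p v,
    f p v - g p v = diff X p (p + 1) v *m h (p + 1) p v
                    + h p (p - 1) v *m diff Y (p - 1) p v.

Definition cocycle (X : bcomplex) p v (x : 'rV[k]_(dim (X p) v)) : Prop :=
  x *m diff X p (p + 1) v = 0.
Definition coboundary (X : bcomplex) p v (x : 'rV[k]_(dim (X p) v)) : Prop :=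
  exists y : 'rV_(dim (X (p - 1)) v), x = y *m diff X (p - 1) p v.

(* f induces injective and surjective maps on all cohomology spaces. *)
Definition quasi_iso (X Y : bcomplex) (f : chain_map X Y) : Prop :=
  forall p v,
    (forall x, @cocycle X p v x -> @coboundary Y p v (x *m f p v) ->
       @coboundary X p v x)
    /\ (forall y, @cocycle Y p v y ->
          exists2 x, @cocycle X p v x & @coboundary Y p v (y - x *m f p v)).

Fact quasi_iso1 (X : bcomplex) : quasi_iso (chain1 X).
Proof.
move=> p v; split=> [x _|y cy]; first by rewrite /= mulmx1.
by exists y; rewrite //= mulmx1 subrr; exists 0; rewrite mul0mx.
Qed.

(* Morphisms X -> Y of the bounded derived category are the roofs
   X <- apex -> Y modulo roof_eq: the localisation of the homotopy category
   of bounded complexes at the quasi-isomorphisms. *)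
Record roof (X Y : bcomplex) := Roof {
  apex : bcomplex;
  den : chain_map apex X;
  num : chain_map apex Y;
  den_quasi_iso : quasi_iso den }.

Definition roof_eq (X Y : bcomplex) (r s : roof X Y) : Prop :=
  exists (Z : bcomplex) (t : chain_map Z (apex r)) (u : chain_map Z (apex s)),
    [/\ quasi_iso (chain_comp t (den r)),
        homotopic (chain_comp t (den r)) (chain_comp u (den s))
      & homotopic (chain_comp t (num r)) (chain_comp u (num s))].

Definition roof0 (X Y : bcomplex) : roof X Y :=
  Roof (chain0 X Y) (@quasi_iso1 X).

Section Shift.
Variables (s : int) (X : bcomplex).
Let sdiff p q := hom_scale ((-1) ^ s) (diff X (p + s) (q + s)).
Fact shift_shape p q v : q != p + 1 -> sdiff p q v = 0.
Proof.
move=> ne; rewrite /= diff_shape ?scaler0 //.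
by rewrite addrAC (inj_eq (addIr s)).
Qed.
Fact shift_diff_comp p q r v : sdiff p q v *m sdiff q r v = 0.
Proof. by rewrite /= -scalemxAl -scalemxAr diff_comp !scaler0. Qed.
Fact shift_bounded :
  exists N : nat, forall p v, (N < `|p|)%N -> dim (X (p + s)) v = 0%N.
Proof.
have [N bN] := bounded X; exists (N + `|s|)%N => p v ltNp; apply: bN.
rewrite -(ltn_add2r `|s|); apply: (leq_trans ltNp).
by rewrite -{1}(addrK s p) (leq_trans (leqD_dist _ 0 _)) // sub0r subr0 abszN.
Qed.
Definition shift : bcomplex :=
  @BComplex (fun p => X (p + s)) sdiff shift_shape shift_diff_comp
    shift_bounded.
End Shift.

Section Stalk.
Variable M : rep.
Let sobj (p : int) : rep := if p == 0 then M else rep0.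
Fact stalk_comp p q r v :
  hom0 (sobj p) (sobj q) v *m hom0 (sobj q) (sobj r) v = 0.
Proof. exact: mul0mx. Qed.
Fact stalk_bounded :
  exists N : nat, forall p v, (N < `|p|)%N -> dim (sobj p) v = 0%N.
Proof. by exists 0%N => p v; rewrite absz_gt0 /sobj => /negPf ->. Qed.
Definition stalk : bcomplex :=
  @BComplex sobj (fun p q => hom0 (sobj p) (sobj q)) (fun _ _ _ _ => erefl)
    stalk_comp stalk_bounded.
End Stalk.

(* Morphisms X -> Y of the orbit category D^b(kQ)/[2] are the elements of the
   direct sum over m of the Hom(X, Y[2m]): families of finite support, modulo
   componentwise equality in the derived category. *)
Record root_hom (X Y : bcomplex) := RootHom {
  component :> forall m : int, roof X (shift (m *+ 2) Y);
  finite_support : exists N : nat, forall m, (N < `|m|)%N ->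
    roof_eq (component m) (roof0 X (shift (m *+ 2) Y)) }.

Definition root_hom_eq (X Y : bcomplex) (f g : root_hom X Y) : Prop :=
  forall m, roof_eq (f m) (g m).

Fact roof_eq_refl (X Y : bcomplex) (r : roof X Y) : roof_eq r r.
Proof.
have hrefl (W : bcomplex) (f : chain_map (apex r) W) :
    homotopic (chain_comp (chain1 _) f) (chain_comp (chain1 _) f).
  exists (fun p q => hom0 _ _) => p v.
  by rewrite subrr /= mulmx0 mul0mx addr0.
exists (apex r), (chain1 _), (chain1 _); split=> // p v.
have [inj surj] := @den_quasi_iso _ _ r p v.
split=> [x cx|y cy]; first by rewrite /= mul1mx; apply: inj.
by have [x cx bx] := surj y cy; exists x; rewrite //= mul1mx.
Qed.

Definition root_hom0 (X Y : bcomplex) : root_hom X Y :=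
  @RootHom X Y (fun m => roof0 X (shift (m *+ 2) Y))
    (ex_intro _ 0%N (fun m _ => roof_eq_refl _)).

Definition root_hom_is_zero (X Y : bcomplex) : Prop :=
  forall f : root_hom X Y, root_hom_eq f (root_hom0 X Y).

Definition root_ext1_is_zero (X Y : bcomplex) : Prop :=
  root_hom_is_zero X (shift 1 Y).

End Representations.

(* The vertices 1, ..., m are represented by 0, ..., m.-1; the arrow a goes
   from a.+1 to a. *)
Fact linear_source_subproof m (a : 'I_m.-1) : (a.+1 < m)%N.
Proof. by case: m a => [|m] []. Qed.

Definition linear_quiver (m : nat) : quiver :=
  @Quiver 'I_m 'I_m.-1
    (fun a => Ordinal (linear_source_subproof a))
    (widen_ord (leq_pred m)).

(* The representation with k at the vertices i, ..., j - 1, and with identity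
   maps between them: its socle is the simple module at i, and its length is
   j - i.  The matrix const_mx 1 is the identity when both of its dimensions
   are 1, and is empty otherwise. *)
Definition interval_rep (k : fieldType) m (i j : nat) :
    rep k (linear_quiver m) :=
  @Rep k (linear_quiver m) (fun v : 'I_m => nat_of_bool (i <= v < j)%N)
    (fun=> const_mx 1).

(* The object M_ij of the oriented edge e = [i, j], where
   M_ji = M_ij[1] for i < j.  Only used for i <> j. *)
Definition edge_object (k : fieldType) n (e : 'I_n * 'I_n) :
    bcomplex k (linear_quiver n.-1) :=
  if (e.1 < e.2)%N then stalk (interval_rep k n.-1 e.1 e.2)
  else shift 1 (stalk (interval_rep k n.-1 e.2 e.1)).

(* The indecomposable objects up to isomorphism are identified with the
   oriented edges. *)
Definition oriented_edges n : {set 'I_n * 'I_n} := [set e | e.1 != e.2].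

Section Frames.
Variables (k : fieldType) (n : nat).
Implicit Types (X Y : 'I_n * 'I_n) (C : {set 'I_n * 'I_n}).
Let M := @edge_object k n.

Definition starting_frame X Y : Prop :=
  ~ root_hom_is_zero (M X) (M Y) /\ root_ext1_is_zero (M Y) (M X).

Definition ending_frame X Y : Prop :=
  ~ root_hom_is_zero (M Y) (M X) /\ root_ext1_is_zero (M X) (M Y).

Definition frame X Y : Prop := starting_frame X Y \/ ending_frame X Y.

Definition frame_free C : Prop :=
  C \subset oriented_edges n
  /\ forall X Y, X \in C -> Y \in C -> X != Y -> ~ frame X Y.

Definition frame_free_configuration C : Prop :=
  frame_free C /\ forall C', C \subset C' -> frame_free C' -> C' = C.

Definition maximum_configuration C : Prop :=
  frame_free_configuration C
  /\ forall C', frame_free_configuration C' -> (#|C'| <= #|C|)%N.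

End Frames.

Definition oriented_cycle n (g : {set 'I_n * 'I_n}) : Prop :=
  exists c : seq 'I_n,
    [/\ uniq c, (2 <= size c)%N & g = [set (x, next c x) | x in c]].

Definition config_sign n (C : {set 'I_n * 'I_n}) : int :=
  \prod_(g : {set 'I_n * 'I_n} | (g \subset C) && `[< oriented_cycle g >])
    (-1) ^+ (#|[set e.1 | e in g]| - 1).

Definition config_weight (F : fieldType) n (U : 'M[F]_n)
    (C : {set 'I_n * 'I_n}) : F :=
  \prod_(e in C) U e.1 e.2.

(* Main.v *)
Require Import Defs.
From HB Require Import structures.
From mathcomp Require Import all_boot all_order all_algebra.
From mathcomp Require Import boolp classical_sets reals.
From mathcomp Require Import complex mpoly.
From mathcomp Require Import fingroup perm zify ring.

Set Implicit Arguments.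
Unset Strict Implicit.
Unset Printing Implicit Defensive.

Import Order.TTheory GRing.Theory Num.Theory.

Local Open Scope ring_scope.

(** An interval module M_ij has the projective resolution M_0i -> M_0j, so
    Hom(M_ij, M_i'j') is nonzero iff i <= i' < j <= j', Ext^1(M_ij, M_i'j') is
    nonzero iff i' < i <= j' < j, and there are no higher extensions.  Hence
    the frame of an oriented edge consists of the edges with the same source or
    the same target, the maximum configurations are the graphs of the
    fixed-point-free permutations, and the sum is the determinant of U.

    Cutting the polygon along the triangulation gives vectors v_1, ..., v_n
    over the field of rational functions such that u_ij = det(v_i, v_j) for
    i < j: the vector at the apex of a triangle is a combination of those at
    its base.  The Ptolemy relations are then identities, and all u_ij are
    nonzero because they are positive at the point where every variable is 1.
    Finally, row 1 of U is a combination of rows 2 and n except on the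
    diagonal, and the determinant follows by induction on n. *)

(** * Representations of the linear quiver *)

Section SmallMatrices.
Variable k : fieldType.

Lemma mx_row0 p q (A B : 'M[k]_(p, q)) : p = 0%N -> A = B.
Proof. by move=> e; subst p; rewrite [A]flatmx0 [B]flatmx0. Qed.

Lemma mx_col0 p q (A B : 'M[k]_(p, q)) : q = 0%N -> A = B.
Proof. by move=> e; subst q; rewrite [A]thinmx0 [B]thinmx0. Qed.

Lemma mulmx_inner0 p q r (A : 'M[k]_(p, q)) (B : 'M_(q, r)) :
  q = 0%N -> A *m B = 0.
Proof. by move=> e; subst q; rewrite [A]thinmx0 mul0mx. Qed.

Lemma const_mx0 p q : const_mx 0 = 0 :> 'M[k]_(p, q).
Proof. by apply/matrixP => r c; rewrite !mxE. Qed.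

Lemma const_mulmx p (b : bool) q (x y : k) : b ->
  (const_mx x : 'M_(p, b)) *m (const_mx y : 'M_(b, q)) = const_mx (x * y).
Proof.
by case: b => // _; apply/matrixP => r c; rewrite !mxE big_ord1 !mxE.
Qed.

Lemma mx_bool_const (b c : bool) (A : 'M[k]_(b, c)) :
  exists x, A = const_mx x.
Proof.
case: b A => A; last by exists 0; apply: mx_row0.
case: c A => A; last by exists 0; apply: mx_col0.
by exists (A 0 0); apply/matrixP => r s; rewrite !mxE !ord1.
Qed.

Lemma const_mx_inj_bool (b c : bool) (x y : k) : b -> c ->
  const_mx x = const_mx y :> 'M[k]_(b, c) -> x = y.
Proof. by case: b c => [] [] // _ _ /matrixP/(_ 0 0); rewrite !mxE. Qed.

Lemma const_mx_eq0_bool (b c : bool) (x : k) : b -> c ->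
  const_mx x = 0 :> 'M[k]_(b, c) -> x = 0.
Proof. by rewrite -const_mx0 => b1 c1; apply: const_mx_inj_bool. Qed.

Lemma const_mx_bool1 (b : bool) : const_mx 1 = 1%:M :> 'M[k]_b.
Proof.
case: b; last exact: mx_row0.
by apply/matrixP => r s; rewrite !mxE !ord1 eqxx.
Qed.
End SmallMatrices.

(** * Morphisms between interval modules *)

Section LinearQuiver.
Variables (k : fieldType) (m : nat).
Local Notation Q := (linear_quiver m).
Local Notation interval := (interval_rep k m).
Local Notation dim := Defs.dim.
Implicit Types (V W : rep k Q) (a : arrow Q) (i j : nat).

Lemma source_target a : source a = (target a).+1 :> nat.
Proof. by []. Qed.

(** Each vertex below [j] is the target of an arrow from the next vertex, so a property that passes
    along arrows spreads downwards. Phrasing the step on arrows keeps the types of [act] free of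
    casts. *)
Lemma descending_ind (j : vertex Q) (T : vertex Q -> Prop) : T j ->
  (forall a, (source a <= j)%N -> T (source a) -> T (target a)) ->
  forall v : vertex Q, (v <= j)%N -> T v.
Proof.
move=> Tj step v; move: {-1}(j - v)%N (erefl (j - v)%N) => d.
elim: d v => [|d IHd] v jv vj.
  by have -> : v = j by apply: val_inj => /=; lia.
have hv : (v < m.-1)%N by have := ltn_ord j; lia.
have tv : target (Ordinal hv : arrow Q) = v by apply: val_inj.
have sv : source (Ordinal hv : arrow Q) = v.+1 :> nat by [].
by rewrite -tv; apply: step; rewrite ?sv; [lia|apply: IHd; rewrite sv; lia].
Qed.

(** The family carries [x0] along the paths that start at [j]; above [j] it is unconstrained. *)
Lemma path_family V (j : vertex Q) (x0 : 'rV[k]_(dim V j)) :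
  exists x : forall v, 'rV[k]_(dim V v), x j = x0 /\
    forall a, (source a <= j)%N -> x (target a) = x (source a) *m act V a.
Proof.
pose T v : Type := 'rV[k]_(dim V v).
(* Stage [d] handles the first [d] arrows below [j]; the next stage overwrites the value at one more
   vertex. *)
suff H d : exists x : forall v, 'rV[k]_(dim V v), x j = x0 /\
    forall a, (source a <= j)%N -> (j <= target a + d)%N ->
      x (target a) = x (source a) *m act V a.
  by have [x [xj xa]] := H j; exists x; split=> // a sa; apply: xa => //; lia.
elim: d => [|d [x [xj xa]]].
  exists (@dfwith _ T (fun=> 0) j x0); split; first exact: dfwith_in.
  by move=> a; rewrite source_target; lia.
have [jd|jd] := leqP j d.
  by exists x; split=> // a sa _; apply: xa => //; lia.
have h0 : (j - d.+1 < m.-1)%N by have := ltn_ord j; lia.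
pose a0 : arrow Q := Ordinal h0.
have ta0 : target a0 = (j - d.+1)%N :> nat by [].
exists (@dfwith _ T x _ (x (source a0) *m act V a0)); split.
  by rewrite dfwith_out ?xj // -val_eqE /=; lia.
move=> a sa ta; have [->|ne] := eqVneq a a0.
  by rewrite dfwith_in dfwith_out // -val_eqE /=; lia.
have ne' : (target a != j - d.+1 :> nat)%N by [].
by rewrite !dfwith_out ?xa // -?val_eqE; move: ta ne' => /=; lia.
Qed.

(** The inequalities make the overlap of the supports a quotient of the first interval and a
    submodule of the second. The guard [c != 0] lets the same construction give the zero morphism
    between arbitrary intervals. *)
Lemma const_hom_act i j i' j' (c : k) :
  (c != 0 -> (i <= i')%N && (j <= j')%N) -> forall a,
  act (interval i j) a *m const_mx c = const_mx c *m act (interval i' j') a.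
Proof.
move=> H a; have [->|/H/andP[ii jj]] := eqVneq c 0.
  by rewrite !const_mx0 mulmx0 mul0mx.
have st := source_target a.
have [sa|sa] := boolP (i <= source a < j)%N; last first.
  by apply: mx_row0; rewrite /= (negPf sa).
have [ta|ta] := boolP (i' <= target a < j')%N; last first.
  by apply: mx_col0; rewrite /= (negPf ta).
have ta' : (i <= target a < j)%N by move: st sa ta; lia.
have sa' : (i' <= source a < j')%N by move: st sa ta; lia.
by rewrite !const_mulmx ?mulr1 ?mul1r.
Qed.

Definition const_hom i j i' j' c H : rep_hom (interval i j) (interval i' j') :=
  @RepHom k Q (interval i j) (interval i' j') (fun=> const_mx c)
    (const_hom_act H).

Lemma ray_hom_act V j (x : forall v, 'rV[k]_(dim V v)) :
  (forall a, (source a < j)%N -> x (target a) = x (source a) *m act V a) ->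
  forall a, act (interval 0 j) a *m (const_mx 1 *m x (target a))
    = const_mx 1 *m x (source a) *m act V a.
Proof.
move=> H a; have [sa|sa] := ltnP (source a) j; last first.
  by apply: mx_row0; rewrite /= ltnNge sa.
have st := source_target a.
by rewrite mulmxA const_mulmx ?mulr1 -?mulmxA ?H //; lia.
Qed.

(* [interval 0 j] is projective: a morphism out of it is given by the image of
   a generator at the vertex j - 1, here spread to the vertices below by x. *)
Definition ray_hom V j x H : rep_hom (interval 0 j) V :=
  @RepHom k Q (interval 0 j) V (fun v => const_mx 1 *m x v) (ray_hom_act H).

(** Commutation with the arrows forces one scalar on the whole common support. If [j' < i], the
    arrow from [j'] to [j' - 1] starts where only the second module vanishes, and this kills the
    scalar. *)
Lemma hom_interval i i' j' (g : rep_hom (interval 0 i) (interval i' j')) :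
  (i <= m)%N -> (i' < j' <= m)%N ->
  exists c, (forall v, g v = const_mx c) /\ (c != 0 -> (i' < i <= j')%N).
Proof.
move=> im ijm; have [ii'|i'i] := leqP i i'.
  exists 0; rewrite eqxx; split=> // v; have [vi|iv] := ltnP v i.
    by apply: mx_col0; rewrite /= leqNgt (leq_trans vi ii').
  by apply: mx_row0; rewrite /= ltnNge iv.
(* The highest vertex of the common support, from which the scalar spreads down. *)
have h0 : (minn i j' - 1 < m)%N by lia.
pose v0 : vertex Q := Ordinal h0.
have [c gc] := mx_bool_const (g v0).
have step a : (i' <= target a)%N -> (source a < i)%N -> (source a < j')%N ->
    g (source a) = const_mx c -> g (target a) = const_mx c.
  have st := source_target a.
  move=> it si sj gs; have := hom_act g a; rewrite gs.
  have [x ->] := mx_bool_const (g (target a)).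
  rewrite !const_mulmx ?mulr1 ?mul1r; first last.
  - by move: st; lia.
  - by move: st; lia.
  by move/const_mx_inj_bool => -> //; lia.
have gE v : g v = const_mx c.
  have [vi|iv] := ltnP v i; last by apply: mx_row0; rewrite /= ltnNge iv.
  have [iv|vi'] := leqP i' v; last first.
    by apply: mx_col0; rewrite /= leqNgt vi'.
  have [vj|jv] := ltnP v j'; last first.
    by apply: mx_col0; rewrite /= ltnNge jv andbF.
  suff : (i' <= v)%N -> g v = const_mx c by apply.
  apply: (@descending_ind v0 (fun v => (i' <= v)%N -> g v = const_mx c)) => //.
    move=> a sa gs it; have st := source_target a.
    have sa' : (source a <= minn i j' - 1)%N := sa.
    by apply: (step _ it _ _ (gs _)); move: st sa' it => /=; lia.
  by rewrite /=; lia.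
exists c; split=> // c0; rewrite /= leqNgt; apply: contra c0 => ji.
have hj : (j'.-1 < m.-1)%N by lia.
pose a : arrow Q := Ordinal hj.
have ta : target a = j'.-1 :> nat by [].
have sa : source a = j' :> nat by rewrite source_target ta; lia.
have := hom_act g a; rewrite [RHS]mulmx_inner0; last first.
  change (nat_of_bool (i' <= source a < j')%N = 0%N).
  by rewrite sa ltnn andbF.
rewrite gE const_mulmx ?mul1r; last by rewrite ta; lia.
rewrite -(const_mx0 k) => /const_mx_inj_bool -> //.
  by rewrite sa.
by rewrite ta; lia.
Qed.
End LinearQuiver.
(** * Morphisms in the derived category *)

Lemma intB1_neq (p : int) : p - 1 != p.
Proof. by apply/eqP; lia. Qed.

Lemma intD1_neq (p : int) : p + 1 != p.
Proof. by apply/eqP; lia. Qed.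

Section DerivedCategory.
Variables (k : fieldType) (m : nat).
Local Notation Q := (linear_quiver m).
Local Notation interval := (interval_rep k m).
Local Notation dim := Defs.dim.
Local Notation complex := (bcomplex k Q).
Implicit Types (X Y Z A : complex) (p q r s : int).
Implicit Types (v : vertex Q) (a : arrow Q).

(** An isomorphism in degree [p], instead of an equality of modules, covers stalks and their shifts
    without transports between equal degrees. *)
Definition concentrated X p (M : rep k Q) : Prop :=
  (exists (f : rep_hom (X p) M) (g : rep_hom M (X p)),
     (forall v, f v *m g v = 1%:M) /\ (forall v, g v *m f v = 1%:M))
  /\ forall q v, q != p -> dim (X q) v = 0%N.

Lemma concentrated_stalk M : concentrated (stalk M) 0 M.
Proof.
split; last by move=> q v /negPf q0; rewrite /= q0.
by exists (hom1 M), (hom1 M); split=> v; rewrite /= mulmx1.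
Qed.

Lemma concentrated_shift s X p M :
  concentrated X p M -> concentrated (shift s X) (p - s) M.
Proof.
case=> iso X0; split; first by rewrite /= subrK.
move=> q v qp; apply: X0; apply: contraNneq qp => <-.
by rewrite addrK.
Qed.

(** Neighbouring degrees become variables tied by equations, so that degrees such as [p - 1 + 1] and
    [p] can be matched without casts. The variants for coboundaries and cocycles serve the same
    end. *)
Lemma homotopicE X Y (f g : chain_map X Y) : homotopic f g ->
  exists h : forall p q, rep_hom (X p) (Y q), forall p q r v,
    q = p + 1 -> r = p - 1 ->
    f p v - g p v = diff X p q v *m h q p v + h p r v *m diff Y r p v.
Proof. by case=> h H; exists h => p q r v -> ->. Qed.

Lemma coboundaryE X p q v (x : 'rV[k]_(dim (X p) v)) : q = p - 1 ->
  coboundary x -> exists y : 'rV[k]_(dim (X q) v), x = y *m diff X q p v.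
Proof. by move=> -> [y ->]; exists y. Qed.

Lemma coboundaryI X p q v (y : 'rV[k]_(dim (X q) v)) : q = p - 1 ->
  coboundary (y *m diff X q p v).
Proof. by move=> e; subst q; exists y. Qed.

Lemma cocycleE X p q v (x : 'rV[k]_(dim (X p) v)) : q = p + 1 ->
  cocycle x -> x *m diff X p q v = 0.
Proof. by move=> ->. Qed.

Lemma coboundary0 X p v : coboundary (0 : 'rV[k]_(dim (X p) v)).
Proof. by exists 0; rewrite mul0mx. Qed.

Lemma coboundary_chain X Y (f : chain_map X Y) p v (x : 'rV[k]_(dim (X p) v)) :
  coboundary x -> coboundary (x *m f p v).
Proof.
by case=> y ->; rewrite -mulmxA -chain_comm mulmxA; exists (y *m f (p - 1) v).
Qed.

Lemma cocycle_chain X Y (f : chain_map X Y) p v (x : 'rV[k]_(dim (X p) v)) :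
  cocycle x -> cocycle (x *m f p v).
Proof.
by rewrite /cocycle => cx; rewrite -mulmxA chain_comm mulmxA cx mul0mx.
Qed.

Lemma cocycleB X p v (x y : 'rV[k]_(dim (X p) v)) :
  cocycle x -> cocycle y -> cocycle (x - y).
Proof. by rewrite /cocycle mulmxBl => -> ->; rewrite subrr. Qed.

(** A class of [Y] and the image of its lift through the composite agree after [g], hence already in
    [Y], because [g] is injective on cohomology. *)
Lemma quasi_iso_cancel X Y Z (f : chain_map X Y) (g : chain_map Y Z) :
  quasi_iso (chain_comp f g) -> quasi_iso g -> quasi_iso f.
Proof.
move=> qfg qg p v; have [ifg sfg] := qfg p v; have [ig sg] := qg p v.
split=> [x cx bx|y cy].
  by apply: ifg => //; rewrite /= mulmxA; apply: coboundary_chain.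
have [x cx bx] := sfg _ (cocycle_chain g cy); exists x => //.
apply: ig; first exact/cocycleB/cocycle_chain.
by rewrite mulmxBl -mulmxA.
Qed.

(** * The projective resolution of an interval *)

Section Resolution.
Variables (i j : nat) (p : int).
Hypothesis ij : (i < j <= m)%N.

(** Length 0 makes the module [interval 0 0] vanish, so one formula gives the terms in all
    degrees. *)
Definition res_len q := if q == p then j else if q == p - 1 then i else 0%N.

Lemma res_lenp : res_len p = j. Proof. by rewrite /res_len eqxx. Qed.

Lemma res_lenp1 : res_len (p - 1) = i.
Proof. by rewrite /res_len eqxx (negPf (intB1_neq p)). Qed.

Let coef q r : k := ((q == p - 1) && (r == p))%:R.

Lemma res_diff_le q r : coef q r != 0 ->
  (0 <= 0)%N && (res_len q <= res_len r)%N.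
Proof.
rewrite /coef; case: (eqVneq q (p - 1)) => [->|]; last by rewrite eqxx.
case: (eqVneq r p) => [->|]; last by rewrite eqxx.
by rewrite res_lenp res_lenp1 /= => _; case/andP: ij => /ltnW.
Qed.

Definition res_diff q r :
    rep_hom (interval 0 (res_len q)) (interval 0 (res_len r)) :=
  const_hom m (@res_diff_le q r).

Fact res_shape q r v : r != q + 1 -> res_diff q r v = 0.
Proof.
move=> rq; rewrite /= /coef; case: eqP => [qp|]; last by rewrite const_mx0.
case: eqP => [rp|]; last by rewrite const_mx0.
by rewrite rp qp subrK eqxx in rq.
Qed.

Fact res_diff_comp q r s v : res_diff q r v *m res_diff r s v = 0.
Proof.
rewrite /= /coef; have [->|_] := eqVneq r p; last first.
  by rewrite andbF const_mx0 mul0mx.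
by rewrite (eq_sym p) (negPf (intB1_neq p)) const_mx0 mulmx0.
Qed.

Fact res_bounded : exists N : nat, forall q v, (N < `|q|)%N ->
  dim (interval 0 (res_len q)) v = 0%N.
Proof.
exists (`|p| + 1)%N => q v lt_q; rewrite /= /res_len.
by case: eqP => [e|_]; [|case: eqP => [e|_]]; rewrite ?ltn0 //; lia.
Qed.

(* The projective resolution of interval i j, in degrees p - 1 and p. *)
Definition res : complex :=
  @BComplex k Q (fun q => interval 0 (res_len q)) res_diff
    res_shape res_diff_comp res_bounded.

Lemma res_dim0 q v : q != p -> q != p - 1 -> dim (res q) v = 0%N.
Proof. by move=> /negPf qp /negPf qp1; rewrite /= /res_len qp qp1 ltn0. Qed.
End Resolution.

(** * Lifting the resolution through a quasi-isomorphism *)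

Section ResolutionMaps.
Variables (i j : nat) (p : int).
Hypothesis ij : (i < j <= m)%N.
Local Notation res := (res p ij).

(* A vector of A at the vertex j - 1 mapping to the top of [interval i j]
   determines t in degree p; its image at the vertex i - 1 is a coboundary, and
   a preimage determines t in degree p - 1. *)
Lemma lift_resolution X A (den : chain_map A X) :
  concentrated X p (interval i j) -> quasi_iso den ->
  exists t : chain_map res A, quasi_iso (chain_comp t den).
Proof.
move=> [[f [g [fg gf]]] X0] qden.
have p1 := intB1_neq p.
have pp1 : p = p - 1 + 1 by rewrite subrK.
have [i_lt_j j_le_m] := andP ij.
have hj : (j.-1 < m)%N by lia.
pose v1 : vertex Q := Ordinal hj.
(* The images in [X] of the basis vectors of [interval i j], zero outside its support. *)
pose gen v : 'rV[k]_(dim (X p) v) := const_mx 1 *m g v.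
have gen_step a : (source a < j)%N ->
    gen (target a) = gen (source a) *m act (X p) a.
  have st := source_target a.
  move=> sj; rewrite /gen -[RHS]mulmxA -hom_act mulmxA; congr (_ *m _).
  have [ti|it] := ltnP (target a) i.
    by apply: mx_col0; rewrite /= leqNgt ti.
  by rewrite const_mulmx ?mulr1 //; move: st it sj => /=; lia.
have cobX v (x : 'rV[k]_(dim (X p) v)) : coboundary x -> x = 0.
  by case=> y ->; apply: mulmx_inner0; apply: X0.
have cocX v (x : 'rV[k]_(dim (X p) v)) : cocycle x.
  exact/mx_col0/X0/intD1_neq.
have [a1 ca1 ba1] : exists2 a1 : 'rV[k]_(dim (A p) v1),
    cocycle a1 & a1 *m den p v1 = gen v1.
  have [_ /(_ _ (cocX _ (gen v1)))[a1 ca1 /cobX/eqP]] := qden p v1.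
  by rewrite subr_eq0 => /eqP e; exists a1.
have [ya [ya1 ya_step]] := path_family a1.
have below (T : vertex Q -> Prop) : T v1 ->
    (forall a, (source a < j)%N -> T (source a) -> T (target a)) ->
    forall v : vertex Q, (v < j)%N -> T v.
  move=> T1 step v vj; apply: (descending_ind T1) => [a sa|].
    by apply: step; rewrite (leq_ltn_trans sa) //=; lia.
  by rewrite /=; lia.
have ya_cocycle v : (v < j)%N -> cocycle (ya v).
  apply: (below (fun v => cocycle (ya v))); first by rewrite ya1.
  move=> a sa; rewrite /cocycle ya_step; last first.
    by rewrite /=; move: sa => /=; lia.
  by rewrite -mulmxA hom_act mulmxA => ->; rewrite mul0mx.
have ya_den v : (v < j)%N -> ya v *m den p v = gen v.
  apply: (below (fun v => ya v *m den p v = gen v)); first by rewrite ya1.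
  move=> a sa; rewrite ya_step; last by rewrite /=; move: sa => /=; lia.
  by rewrite gen_step // -mulmxA hom_act mulmxA => ->.
(* At the vertex [i - 1] the interval vanishes, so [ya] maps to zero in [X] and is a coboundary in
   [A]. A preimage there is spread downwards. *)
have [yb [yb_step yb_diff]] : exists yb : forall v, 'rV[k]_(dim (A (p - 1)) v),
    (forall a, (source a < i)%N -> yb (target a) = yb (source a) *m act _ a) /\
    forall v : vertex Q, (v < i)%N -> yb v *m diff A (p - 1) p v = ya v.
  have [i0|i0] := posnP i.
    by exists (fun=> 0); split=> ?; rewrite i0.
  have hi : (i.-1 < m)%N by lia.
  pose v2 : vertex Q := Ordinal hi.
  have v2i : (v2 < i)%N by rewrite /=; lia.
  have gen0 : gen v2 = 0.
    rewrite /gen; apply: mulmx_inner0; rewrite /= ?ltnNge.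
    by have -> : (i <= i.-1)%N = false by lia.
  have ca2 : cocycle (ya v2) by apply: ya_cocycle; apply: ltn_trans i_lt_j.
  have [inj _] := qden p v2.
  have : coboundary (ya v2).
    apply: inj => //; rewrite ya_den ?gen0; first exact: coboundary0.
    exact: ltn_trans i_lt_j.
  case=> b1 b1E; have [yb [yb1 yb_step]] := path_family b1.
  exists yb; split=> [a sa|v vi].
    by apply: yb_step; rewrite /=; move: sa => /=; lia.
  apply: (@descending_ind m v2 (fun v => yb v *m diff A (p - 1) p v = ya v)).
  - by rewrite yb1 b1E.
  - move=> a sa IH; rewrite yb_step // ya_step -?IH.
      by rewrite -!mulmxA hom_act.
    by rewrite /=; move: sa => /=; lia.
  - by rewrite /=; lia.
pose T q : Type := forall v, 'rV[k]_(dim (A q) v).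
pose y : forall q, T q :=
  @dfwith _ T (@dfwith _ T (fun q v => 0) (p - 1) yb) p ya.
have yp : y p = ya by rewrite /y dfwith_in.
have yp1 : y (p - 1) = yb by rewrite /y dfwith_out ?dfwith_in // eq_sym.
have y_step q a : (source a < res_len i j p q)%N ->
    y q (target a) = y q (source a) *m act (A q) a.
  have [->|qp] := eqVneq q p.
    rewrite res_lenp yp => sa; apply: ya_step.
    by rewrite /=; move: sa => /=; lia.
  have [->|qp1] := eqVneq q (p - 1).
    by rewrite res_lenp1 yp1; apply: yb_step.
  by rewrite /res_len (negPf qp) (negPf qp1).
have t_comm q r v : ray_hom (y_step q) v *m diff A q r v
    = diff res q r v *m ray_hom (y_step r) v.
  have [->|qp] := eqVneq q p.
    have [vj|jv] := ltnP v j; last first.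
      by apply: mx_row0; rewrite /= res_lenp ltnNge jv.
    rewrite /= (eq_sym p) (negPf p1) const_mx0 mul0mx -mulmxA yp.
    have [->|rp] := eqVneq r (p + 1); last by rewrite diff_shape // !mulmx0.
    by rewrite (ya_cocycle _ vj) mulmx0.
  have [->|qp1] := eqVneq q (p - 1); last by apply: mx_row0; apply: res_dim0.
  have [vi|iv] := ltnP v i; last first.
    by apply: mx_row0; rewrite /= res_lenp1 ltnNge iv.
  have [->|rp] := eqVneq r p; last first.
    rewrite res_shape -?pp1 // diff_shape -?pp1 //.
    by rewrite mulmx0 mul0mx.
  rewrite /= !eqxx mulmxA const_mulmx; last by rewrite res_lenp (ltn_trans vi).
  by rewrite mulr1 -mulmxA yp yp1 yb_diff.
pose t := @ChainMap k Q res A (fun q => ray_hom (y_step q)) t_comm.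
(* Outside degree [p] there is no cohomology: the differential of [res] is injective in degree
   [p - 1], and the remaining terms are zero. *)
exists t; move=> q v; have [->|qp] := eqVneq q p; last first.
  split=> [x cx _|y' _]; last first.
    exists 0; first by rewrite /cocycle mul0mx.
    by rewrite (_ : y' - _ = 0); [apply: coboundary0|apply/mx_col0/X0].
  suff -> : x = 0 by apply: coboundary0.
  have [qp1|qp1] := eqVneq q (p - 1); last by apply/mx_col0/res_dim0.
  subst q; have [vi|iv] := ltnP v i; last first.
    by apply: mx_col0; rewrite /= res_lenp1 ltnNge iv.
  have := cocycleE pp1 cx; have [c ->] := @mx_bool_const k true _ x.
  rewrite /= !eqxx const_mulmx ?res_lenp1 // mulr1.
  move=> /(@const_mx_eq0_bool k true _) -> //; rewrite ?const_mx0 //.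
  by rewrite res_lenp (ltn_trans vi).
have tdE : (v < j)%N ->
    chain_comp t den p v = const_mx 1 *m g v.
  move=> vj; rewrite /= -mulmxA yp ya_den // /gen mulmxA.
  by rewrite (@const_mulmx k _ true) // mulr1.
have ivj0 (y' : 'rV[k]_(dim (X p) v)) : ~~ (i <= v < j)%N -> y' = 0.
  move=> ivj; rewrite -(mulmx1 y') -fg mulmxA mulmx_inner0 //.
  by rewrite /= (negPf ivj).
(* In degree [p], vectors of [res] below the vertex [i] are coboundaries, and from [i] to [j - 1]
   the composite is the given isomorphism. *)
split=> [x cx /cobX|y' cy].
  have [vj|jv] := ltnP v j; last first.
    by move=> _; rewrite (_ : x = 0); [apply: coboundary0|
      apply: mx_col0; rewrite /= res_lenp ltnNge jv].
  have [c ->] := @mx_bool_const k true _ x.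
  have [vi|iv] := ltnP v i.
    move=> _; exists (const_mx c); rewrite /= !eqxx.
    by rewrite const_mulmx ?mulr1 // res_lenp1.
  rewrite tdE // mulmxA const_mulmx ?res_lenp // => /(congr1 (mulmx^~ (f v))).
  rewrite -mulmxA gf mulmx1 mul0mx mulr1.
  move=> /(@const_mx_eq0_bool k true _) ->; rewrite ?iv ?vj //.
  by rewrite const_mx0; apply: coboundary0.
exists (y' *m f v *m const_mx 1).
  by apply/mx_col0/res_dim0; lia.
rewrite (_ : y' - _ = 0); first exact: coboundary0.
apply/eqP; rewrite subr_eq0; apply/eqP.
have [ivj|/ivj0 y0] := boolP (i <= v < j)%N; last by rewrite [LHS]y0 [RHS]y0.
have [iv vj] := andP ivj.
rewrite tdE // mulmxA -[_ *m const_mx 1 *m const_mx 1]mulmxA const_mulmx.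
  by rewrite mulr1 const_mx_bool1 mulmx1 -mulmxA fg mulmx1.
by rewrite res_lenp.
Qed.
End ResolutionMaps.
Lemma homotopic_ext X Y (f g : chain_map X Y) :
  (forall q v, f q v = g q v) -> homotopic f g.
Proof.
move=> fg; exists (fun _ _ => hom0 _ _) => q v.
by rewrite fg subrr /= mulmx0 mul0mx addr0.
Qed.

(** * Vanishing and non-vanishing of Hom and Ext between intervals *)

Section HomBetweenIntervals.
Variables (i j i' j' : nat) (p q : int).
Hypotheses (ij : (i < j <= m)%N) (ij' : (i' < j' <= m)%N).
Local Notation res := (res p ij).

(** The map [s] is a scalar [c] in degree [q] and zero elsewhere. For [q = p], a nonzero [c] would
    be visible at the vertex [i - 1], against compatibility with the differential. For [q = p - 1],
    it extends from [interval 0 i] to [interval 0 j], which gives the homotopy. *)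
Lemma res_null Y (s z : chain_map res Y) : concentrated Y q (interval i' j') ->
  ~~ [&& q == p, (i <= i' < j)%N & (j <= j')%N] ->
  ~~ [&& q == p - 1, (i' < i)%N & (i <= j' < j)%N] ->
  (forall r v, z r v = 0) -> homotopic s z.
Proof.
move=> [[f [g [fg gf]]] Y0] nhom next z0.
have [i_lt_j j_le_m] := andP ij; have [i'_lt_j' j'_le_m] := andP ij'.
have lenm r : (res_len i j p r <= m)%N.
  by rewrite /res_len; case: eqP => // _; case: eqP => //; lia.
have [c [gc c0]] := hom_interval (hom_comp (s q) f) (lenm q) ij'.
have sE v : s q v = const_mx c *m g v.
  by rewrite -gc /= -mulmxA fg mulmx1.
have [cz|cnz] := eqVneq c 0.
  apply: homotopic_ext => r v; rewrite z0.
  have [->|rq] := eqVneq r q; last exact/mx_col0/Y0.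
  by rewrite sE cz const_mx0 mul0mx.
have {}c0 := c0 cnz.
have [qp|qp] := eqVneq q p.
  subst q; rewrite res_lenp in c0; rewrite eqxx /= in nhom.
  have [hi i'i] : (i.-1 < m)%N /\ (i' < i)%N by move: nhom c0; lia.
  have [v vE] : exists v : vertex Q, v = i.-1 :> nat by exists (Ordinal hi).
  have := chain_comm s (p - 1) p v; rewrite mulmx_inner0; last first.
    exact/Y0/intB1_neq.
  move=> /esym/(congr1 (mulmx^~ (f v))); rewrite mul0mx sE.
  rewrite mulmxA -mulmxA gf mulmx1 /= !eqxx const_mulmx; last first.
    by rewrite res_lenp; lia.
  rewrite mul1r => /const_mx_eq0_bool e; move: cnz.
  by rewrite e ?eqxx // ?res_lenp1 //=; move: i'i c0; lia.
have [qp1|qp1] := eqVneq q (p - 1); last first.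
  by move: c0; rewrite /res_len (negPf qp) (negPf qp1) ltn0.
have j_le_j' : (j <= j')%N.
  move: next c0; rewrite qp1 eqxx res_lenp1 /=; lia.
have hle r : c != 0 -> (0 <= i')%N && (res_len i j p r <= j')%N.
  move=> _; rewrite /res_len /=; case: eqP => // _; case: eqP => //; lia.
exists (fun r => @dfwith _ (fun s => rep_hom (res r) (Y s))
  (fun s => hom0 _ _) q (hom_comp (const_hom m (@hle r)) g)) => r v.
have [e|rq] := eqVneq r q; last exact/mx_col0/Y0.
subst r; rewrite dfwith_in dfwith_out ?mul0mx ?addr0; last first.
  by rewrite eq_sym intB1_neq.
have [e1 e2] : q == p - 1 /\ q + 1 == p by rewrite qp1 subrK.
have [len_q len_q1] : res_len i j p q = i /\ res_len i j p (q + 1) = j.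
  by rewrite (eqP e2) qp1 res_lenp res_lenp1.
rewrite z0 subr0 sE /= e1 e2 /= mulmxA.
have [vi|iv] := ltnP v i.
  by rewrite const_mulmx ?mul1r // len_q1 (ltn_trans vi).
by apply: mx_row0; rewrite len_q ltnNge iv.
Qed.

Definition derived_zero X Y : Prop :=
  forall r : roof X Y, roof_eq r (roof0 X Y).

(** Any roof can be rewritten with the resolution as apex, where its numerator is null-homotopic. *)
Lemma derived_zero_interval X Y :
  concentrated X p (interval i j) -> concentrated Y q (interval i' j') ->
  ~~ [&& q == p, (i <= i' < j)%N & (j <= j')%N] ->
  ~~ [&& q == p - 1, (i' < i)%N & (i <= j' < j)%N] ->
  derived_zero X Y.
Proof.
move=> cX cY nhom next r.
have [t qt] := lift_resolution ij cX (den_quasi_iso r).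
exists res, t, (chain_comp t (den r)); split=> //.
  by apply: homotopic_ext => s v; rewrite /= mulmx1.
by apply: (res_null _ cY) => // s v; rewrite /= mulmx0.
Qed.
(** If the constant morphism vanished, a generator at the vertex [i'], common to both supports,
    would lift to a cocycle [z] of [Z]. The homotopy then sends [z] to zero, whereas its image has
    coordinate 1. *)
Lemma derived_hom_nonzero X Y :
  concentrated X p (interval i j) -> concentrated Y p (interval i' j') ->
  (i <= i' < j)%N && (j <= j')%N -> ~ derived_zero X Y.
Proof.
move=> [[f [g [fg gf]]] X0] [[f' [g' [fg' gf']]] Y0] hom XY0.
have le : (1 : k) != 0 -> (i <= i')%N && (j <= j')%N by move: hom; lia.
pose n r := @dfwith _ (fun s => rep_hom (X s) (Y s)) (fun s => hom0 _ _) p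
  (hom_comp (hom_comp f (const_hom m le)) g') r.
have n_comm r s v : n r v *m diff Y r s v = diff X r s v *m n s v.
  have [->|rp] := eqVneq r p; last exact/mx_row0/X0.
  have [->|sp] := eqVneq s p; last exact/mx_col0/Y0.
  by rewrite !diff_shape ?mulmx0 ?mul0mx // eq_sym intD1_neq.
have [Z [t [u [qt _ /homotopicE[h hE]]]]] :=
  XY0 (@Roof k Q X Y X (chain1 X) (@ChainMap k Q X Y n n_comm)
    (@quasi_iso1 k Q X)).
have hi : (i' < m)%N by move: ij'; lia.
have [v vE] : exists v : vertex Q, v = i' :> nat by exists (Ordinal hi).
pose x : 'rV[k]_(dim (X p) v) := const_mx 1 *m g v.
have [_ /(_ x)] := qt p v.
case=> [|z cz [y]].
  exact/mx_col0/X0/intD1_neq.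
rewrite [RHS]mulmx_inner0; last first.
  exact/X0/intB1_neq.
rewrite /= mulmx1 => /eqP; rewrite subr_eq0 => /eqP xE.
have := hE p (p + 1) (p - 1) v erefl erefl.
rewrite /= mulmx0 subr0 [X in _ + X]mulmx_inner0 ?addr0; last first.
  exact/Y0/intB1_neq.
move/(congr1 (mulmx z)); rewrite mulmxA -xE mulmxA [in RHS]cz mul0mx.
rewrite /n dfwith_in /= /x.
move/(congr1 (mulmx^~ (f' v))); rewrite mul0mx -!mulmxA gf' mulmx1.
rewrite (mulmxA (g v)) gf mul1mx.
have vij : (i <= v < j)%N by rewrite vE; move: hom; lia.
rewrite const_mulmx ?vij // => /(@const_mx_eq0_bool k true _).
rewrite mulr1 => e; have/eqP := oner_neq0 k; apply; apply: e => //.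
by rewrite vE; move: hom ij'; lia.
Qed.

(** The nonzero class is the roof with apex [res] whose numerator is the constant morphism on
    [interval 0 i]. Its vanishing would amount to an extension to [interval 0 j], which [j' < j]
    excludes. *)
Lemma derived_ext_nonzero X Y : q = p - 1 ->
  concentrated X p (interval i j) -> concentrated Y q (interval i' j') ->
  (i' < i)%N && (i <= j' < j)%N -> ~ derived_zero X Y.
Proof.
move=> qp cX [[f' [g' [fg' gf']]] Y0] ext XY0.
have p1 := intB1_neq p.
have [i_lt_j j_le_m] := andP ij.
have [t0 qden] := lift_resolution ij cX (@quasi_iso1 k Q X).
have len_q : res_len i j p q = i by rewrite qp res_lenp1.
have le : (1 : k) != 0 -> (0 <= i')%N && (res_len i j p q <= j')%N.
  by rewrite len_q; move: ext; lia.
pose n r := @dfwith _ (fun s => rep_hom (res s) (Y s)) (fun s => hom0 _ _) q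
  (hom_comp (const_hom m le) g') r.
have n_comm r s v : n r v *m diff Y r s v = diff res r s v *m n s v.
  have [e|sq] := eqVneq s q; last exact/mx_col0/Y0.
  subst s; transitivity (0 : 'M[k]_(dim (res r) v, dim (Y q) v)).
    have [->|rq] := eqVneq r q; last exact/mulmx_inner0/Y0.
    by rewrite diff_shape ?mulmx0 // eq_sym intD1_neq.
  rewrite /= (_ : (q == p) = false); last by rewrite qp (negPf p1).
  by rewrite andbF const_mx0 mul0mx.
have [Z [t [u [qtd _ /homotopicE[h hE]]]]] :=
  XY0 (@Roof k Q X Y res _ (@ChainMap k Q res Y n n_comm) qden).
have qt := quasi_iso_cancel qtd qden.
have hj : (j.-1 < m)%N by lia.
have hi : (i.-1 < m)%N by lia.
have [v1 v1E] : exists v : vertex Q, v = j.-1 :> nat by exists (Ordinal hj).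
have [v2 v2E] : exists v : vertex Q, v = i.-1 :> nat by exists (Ordinal hi).
pose e v : 'rV[k]_(dim (res p) v) := const_mx 1.
have coc v : cocycle (e v).
  rewrite /cocycle; apply/mx_col0/res_dim0; lia.
have [a1 ca1 a1t] : exists2 a1 : 'rV[k]_(dim (Z p) v1),
    cocycle a1 & a1 *m t p v1 = e v1.
  have [_ /(_ _ (coc v1))[a1 ca1 [y]]] := qt p v1.
  rewrite [RHS]mulmx_inner0; last by rewrite /= res_lenp1 v1E; lia.
  by move/eqP; rewrite subr_eq0 => /eqP; exists a1.
have [ya [ya1 ya_step]] := path_family a1.
have v2v1 : (v2 <= v1)%N by rewrite v1E v2E; lia.
have ya_t : cocycle (ya v2) /\ ya v2 *m t p v2 = e v2.
  apply: (@descending_ind m v1 (fun v => cocycle (ya v)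
    /\ ya v *m t p v = e v)) v2v1 => [|a sa [ca at_]]; first by rewrite ya1.
  rewrite /cocycle ya_step // -!mulmxA !hom_act !mulmxA ca mul0mx at_.
  split=> //; rewrite /e const_mulmx //.
    by rewrite mulr1.
  by rewrite res_lenp; move: sa v1E; lia.
(* The module [interval i' j'] vanishes at the vertex [j - 1], so the homotopy kills the lifted
   generator there and hence its image at [i - 1]. *)
have ya_h : ya v2 *m h p q v2 = 0.
  apply: (@descending_ind m v1 (fun v => ya v *m h p q v = 0)) v2v1
    => [|a sa H].
    rewrite -[LHS]mulmx1 -fg' mulmxA mulmx_inner0 //.
    change (nat_of_bool (i' <= v1 < j')%N = 0%N).
    by rewrite v1E [X in nat_of_bool X](_ : _ = false) //; lia.
  by rewrite ya_step // -mulmxA hom_act mulmxA H mul0mx.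
have v2i : (v2 < i)%N by rewrite v2E; move: ext; lia.
(* At the vertex [i - 1] the generator of [res] is a coboundary, hence so is its lift; [t] then
   sends [b] to the generator in degree [p - 1]. *)
have [b bE] : exists b : 'rV[k]_(dim (Z q) v2), ya v2 = b *m diff Z q p v2.
  have [inj _] := qt p v2; apply: coboundaryE => //.
  apply: inj; first exact: ya_t.1.
  rewrite ya_t.2; have -> : e v2 = const_mx 1 *m diff res (p - 1) p v2.
    rewrite /= !eqxx (@const_mulmx k 1) ?mulr1 //.
    by rewrite res_lenp1 v2i.
  exact: coboundaryI.
have [c cE] := @mx_bool_const k true _ (b *m t q v2).
have c1 : c = 1.
  have := ya_t.2; rewrite bE -mulmxA -chain_comm mulmxA cE /= qp !eqxx.
  rewrite const_mulmx ?res_lenp1 // mulr1.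
  by apply: (@const_mx_inj_bool k true) => //; rewrite res_lenp; lia.
have pq : p = q + 1 by rewrite qp subrK.
have := hE q p (q - 1) v2 pq erefl.
rewrite /= mulmx0 subr0 [X in _ + X]mulmx_inner0 ?addr0; last first.
  exact/Y0/intB1_neq.
move/(congr1 (mulmx b)); rewrite !mulmxA -bE ya_h cE c1.
rewrite /n dfwith_in /= mulmxA const_mulmx; last by rewrite len_q v2i.
move/(congr1 (mulmx^~ (f' v2))); rewrite mul0mx -mulmxA gf' mulmx1 mulr1.
move=> /(@const_mx_eq0_bool k true _) z; have/eqP := oner_neq0 k; apply.
by apply: z => //; rewrite v2E; move: ext; lia.
Qed.
End HomBetweenIntervals.
End DerivedCategory.
(** * Maximum configurations and derangements *)

Section PermutationGraphs.
Variable n : nat.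
Implicit Types (s : 'S_n) (C g : {set 'I_n * 'I_n}).

Definition perm_graph s : {set 'I_n * 'I_n} := [set (x, s x) | x : 'I_n].

Lemma mem_perm_graph s e : (e \in perm_graph s) = (e.2 == s e.1).
Proof.
apply/imsetP/eqP => [[x _ ->] //|es].
by exists e.1; rewrite // -es -surjective_pairing.
Qed.

Lemma perm_graph_inj : injective perm_graph.
Proof.
move=> s t est; apply/permP => x.
have := mem_perm_graph s (x, s x).
by rewrite est mem_perm_graph eqxx => /eqP.
Qed.

Lemma card_perm_graph s : #|perm_graph s| = n.
Proof. by rewrite card_imset ?card_ord // => x y []. Qed.

Lemma config_weight_perm_graph (F : fieldType) (U : 'M[F]_n) s :
  config_weight U (perm_graph s) = \prod_i U i (s i).
Proof. by rewrite /config_weight big_imset // => x y _ _ []. Qed.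

Definition orbit_graph s (O : {set 'I_n}) : {set 'I_n * 'I_n} :=
  [set (x, s x) | x in O].

Lemma orbit_graph_inj s : injective (orbit_graph s).
Proof. by apply: imset_inj => x y []. Qed.

Lemma sources_orbit_graph s O : [set e.1 | e in orbit_graph s O] = O.
Proof. by rewrite -imset_comp imset_id. Qed.

Lemma porbit_orbit s x y : (y \in porbit s x) = (y \in orbit s x).
Proof.
rewrite -fconnect_orbit; apply/porbitP/idP => [[i ->]|/iter_findex <-].
  by rewrite permX fconnect_iter.
by exists (findex s x y); rewrite permX.
Qed.

(** A cycle inside the graph follows [s] from each of its vertices, hence runs through one orbit.
    Conversely, the absence of fixed points gives every orbit at least two vertices. *)
Lemma oriented_cycle_porbit s g : (forall x, s x != x) ->
  (g \subset perm_graph s) && `[< oriented_cycle g >]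
  = (g \in orbit_graph s @: porbits s).
Proof.
move=> der; apply/andP/imsetP => [[gs /asboolP[c [uc c2 gE]]]|].
  have nextE x : x \in c -> next c x = s x.
    move=> xc; have /(fintype.subsetP gs) : (x, next c x) \in g.
      by rewrite gE; apply/imsetP; exists x.
    by rewrite mem_perm_graph => /eqP.
  have fc : fcycle s c.
    by apply: (cycle_from_next uc) => y yc; rewrite /= nextE.
  have [x xc] : exists x, x \in c.
    by case: c c2 {uc gE nextE fc} => // x c _; exists x; rewrite mem_head.
  have memO y : (y \in porbit s x) = (y \in c).
    by have [i e] := orbit_rot_cycle fc uc xc; rewrite porbit_orbit e mem_rot.
  exists (porbit s x); first exact: imset_f.
  rewrite gE; apply/setP => e; apply/imsetP/imsetP => [] [y yc ->].
    by exists y; rewrite ?nextE ?memO.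
  by move: yc; rewrite memO => yc; exists y; rewrite ?nextE.
case=> O /imsetP[x _ ->] ->; split.
  by apply/fintype.subsetP => e /imsetP[y _ ->]; rewrite mem_perm_graph.
have fc := cycle_orbit (@perm_inj _ s) x.
have uc := orbit_uniq s x.
apply/asboolP; exists (orbit s x); split=> //.
  case E: (orbit s x) (in_orbit s x) fc => [|y [|z c]] //=.
  by rewrite andbT (negPf (der y)).
apply/setP => e; apply/imsetP/imsetP => [] [y yc ->]; exists y.
- by rewrite -porbit_orbit.
- by rewrite (nextE fc) // -porbit_orbit.
- by rewrite porbit_orbit.
- by rewrite (nextE fc yc).
Qed.

Lemma config_sign_perm_graph s : (forall x, s x != x) ->
  config_sign (perm_graph s) = (-1) ^+ s.
Proof.
move=> der; rewrite /config_sign.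
rewrite (eq_bigl (mem (orbit_graph s @: porbits s))) => [|g]; last first.
  exact: oriented_cycle_porbit.
rewrite big_imset /=; last by move=> ? ? _ _; apply: orbit_graph_inj.
under eq_bigr => O _ do rewrite sources_orbit_graph.
rewrite prodrXr.
(* The exponents [#|O| - 1] add up to [n] minus the number of orbits, whose parity is that of
   [s]. *)
have sumE : (\sum_(O in porbits s) (#|O| - 1) + #|porbits s| = #|'I_n|)%N.
  rewrite -[RHS]sum1_card (partition_big_imset (porbit s)) /=.
  rewrite -sum1_card -big_split /=; apply: eq_bigr => _ /imsetP[x _ ->].
  rewrite subnK ?lt0n ?card_porbit_neq0 // -sum1_card.
  by apply: eq_bigl => y; rewrite eq_porbit_mem.
by rewrite /odd_perm -[in RHS]sumE oddD addbK signr_odd.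
Qed.

Lemma ordS_neq (x : 'I_n) : (1 < n)%N -> ordS x != x.
Proof.
move=> n1; apply/eqP => /(congr1 val) /=.
have [e|xn] : x.+1 = n \/ (x.+1 < n)%N by have := ltn_ord x; lia.
  by rewrite e modnn; lia.
by rewrite modn_small //; lia.
Qed.

Lemma exists_derangement : (1 < n)%N -> exists s, forall x, s x != x.
Proof.
move=> n1; exists (perm (can_inj (@ordSK n))) => x.
by rewrite permE ordS_neq.
Qed.

End PermutationGraphs.

(** * Maximum configurations as graphs of derangements *)

Section Configurations.
Variables (k : fieldType) (n : nat).
Hypothesis n1 : (1 < n)%N.
Hypothesis frameP : forall X Y : 'I_n * 'I_n, X \in oriented_edges n ->
  Y \in oriented_edges n -> frame k X Y <-> X.1 = Y.1 \/ X.2 = Y.2.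
Implicit Types (s : 'S_n) (C : {set 'I_n * 'I_n}).

Lemma frame_freeP C : frame_free k C <->
  [/\ C \subset oriented_edges n, {in C &, injective fst} &
      {in C &, injective snd}].
Proof.
split=> [[CO ff]|[CO f1 f2]].
  split=> // X Y XC YC e; apply: contrapT => /eqP ne;
    apply: (ff X Y) => //; apply/frameP; rewrite ?(fintype.subsetP CO) //;
    tauto.
split=> // X Y XC YC /eqP ne /frameP[]; rewrite ?(fintype.subsetP CO) // => e.
  exact/ne/f1.
exact/ne/f2.
Qed.

Lemma frame_free_perm_graph s : (forall x, s x != x) ->
  frame_free k (perm_graph s).
Proof.
move=> der; apply/frame_freeP; split.
- apply/fintype.subsetP => e; rewrite mem_perm_graph inE => /eqP ->.
  by rewrite eq_sym.
- move=> [x y] [x' y']; rewrite !mem_perm_graph /= => /eqP -> /eqP -> ->//.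
- move=> [x y] [x' y']; rewrite !mem_perm_graph /= => /eqP -> /eqP ->.
  by move=> /perm_inj ->.
Qed.

Lemma leq_card_frame_free C : frame_free k C -> (#|C| <= n)%N.
Proof.
case/frame_freeP=> _ f1 _.
by rewrite -(card_in_imset f1) (leq_trans (max_card _)) ?card_ord.
Qed.

(** Distinct sources bound a frame-free set by [n] edges, and a derangement reaches this bound. A
    maximum configuration therefore has every vertex as a source, and its distinct targets make it a
    permutation. *)
Lemma maximum_configurationP C : maximum_configuration k C <->
  exists2 s : 'S_n, (forall x, s x != x) & C = perm_graph s.
Proof.
have max s : (forall x, s x != x) ->
    frame_free_configuration k (perm_graph s).
  move=> /frame_free_perm_graph ff; split=> // C' sC' /leq_card_frame_free C'n.
  by apply/esym/eqP; rewrite eqEcard sC' card_perm_graph.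
split=> [[[ffC _] maxC]|[s der ->]]; last first.
  split=> [|C' [/leq_card_frame_free]]; first exact: max.
  by rewrite card_perm_graph.
have [s0 /max /maxC] := exists_derangement n1.
rewrite card_perm_graph => nC.
have /frame_freeP[CO f1 f2] := ffC.
have cC : #|fst @: C| = #|'I_n|.
  apply/eqP; rewrite eqn_leq max_card card_in_imset // card_ord.
  by rewrite nC.
have surj x : exists e, (e \in C) && (e.1 == x).
  have /setP/(_ x) : fst @: C = [set: 'I_n].
    by apply/eqP; rewrite eqEcard finset.subsetT cardsT cC leqnn.
  by rewrite inE => /imsetP[e eC ->]; exists e; rewrite eC eqxx.
pose f x := (xchoose (surj x)).2.
have fC x : (x, f x) \in C.
  have /andP[eC /eqP {1}<-] := xchooseP (surj x).
  by rewrite -surjective_pairing.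
have inj : injective f.
  by move=> x y e; have [] := f2 _ _ (fC x) (fC y) e.
exists (perm inj) => [x|].
  by rewrite permE; have := fintype.subsetP CO _ (fC x); rewrite inE eq_sym.
apply/esym/eqP; rewrite eqEcard card_perm_graph leq_card_frame_free // andbT.
by apply/fintype.subsetP => e /imsetP[x _ ->]; rewrite permE.
Qed.

(** Permutations with a fixed point drop out of the Leibniz expansion because the diagonal is
    zero. *)
Lemma sum_maximum_configuration (F : fieldType) (U : 'M[F]_n) :
  (forall i, U i i = 0) ->
  \sum_(C | `[< maximum_configuration k C >])
     (config_sign C)%:~R * config_weight U C = \det U.
Proof.
move=> U0; rewrite /determinant (bigID (fun s => [forall x, s x != x])) /=.
rewrite [X in _ + X]big1 ?addr0 => [|s]; last first.
  rewrite negb_forall => /existsP[x]; rewrite negbK => /eqP sx.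
  by rewrite (bigD1 x) //= sx U0 mul0r mulr0.
rewrite (eq_bigl (mem (@perm_graph n @:
    [set s : 'S_n | [forall x, s x != x]]))) => [|C]; last first.
  apply/asboolP/imsetP => [/maximum_configurationP[s der ->]|[s + ->]].
    by exists s => //; rewrite inE; apply/forallP.
  rewrite inE => /forallP der; apply/maximum_configurationP.
  by exists s.
rewrite big_imset /=; last by move=> ? ? _ _; apply: perm_graph_inj.
apply: eq_big => [s|s]; first by rewrite inE.
rewrite inE => /forallP der.
by rewrite config_sign_perm_graph // config_weight_perm_graph rmorphXn rmorphN1.
Qed.
End Configurations.
(** * The determinant of a Ptolemy matrix *)

Section PlanarDeterminant.
Variable F : fieldType.
Implicit Types (v : nat -> F * F) (a b : F * F).

Definition det2 a b : F := a.1 * b.2 - b.1 * a.2.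

(** Cramer's rule: for [d = det2 a b] this is the vector [w] with [det2 a w = t] and
    [det2 w b = s]. *)
Definition weighted_sum d s a t b : F * F :=
  ((s * a.1 + t * b.1) / d, (s * a.2 + t * b.2) / d).

Lemma det2_weighted_suml s t a b : det2 a b != 0 ->
  det2 a (weighted_sum (det2 a b) s a t b) = t.
Proof. by rewrite /det2 /= => nz; field. Qed.

Lemma det2_weighted_sumr s t a b : det2 a b != 0 ->
  det2 (weighted_sum (det2 a b) s a t b) b = s.
Proof. by rewrite /det2 /= => nz; field. Qed.

(** The Plücker relation, written as an exchange in the cyclic order [a], [x], [c], [y]; the variant
    below uses the order [b], [a], [c], [y]. *)
Lemma det2_ptolemy a x c y : det2 a c != 0 ->
  det2 x y = (det2 a x * det2 c y + det2 x c * det2 a y) / det2 a c.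
Proof. by rewrite /det2 => nz; field. Qed.

Lemma det2_ptolemyC a y c b : det2 c b != 0 ->
  det2 a y = (det2 a b * det2 c y + det2 a c * det2 y b) / det2 c b.
Proof. by rewrite /det2 => nz; field. Qed.

(** Sorting the indices makes the determinant symmetric. Natural numbers as indices let the
    induction on the size drop the first vector. *)
Definition lam v (i j : nat) : F :=
  if (i < j)%N then det2 (v i) (v j) else det2 (v j) (v i).

Lemma lamC v i j : lam v i j = lam v j i.
Proof. by rewrite /lam; case: ltngtP => // ->. Qed.

Lemma lamii v i : lam v i i = 0.
Proof. by rewrite /lam ltnn /det2 subrr. Qed.

Lemma lam_ptolemy_lt v i j k l : (i < j)%N -> (j < k)%N -> (k < l)%N ->
  lam v i k * lam v j l = lam v i j * lam v k l + lam v j k * lam v l i.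
Proof.
move=> ij jk kl; have [ik jl] := (ltn_trans ij jk, ltn_trans jk kl).
by rewrite (lamC v l) /lam ij jk kl ik jl (ltn_trans ij jl) /det2; ring.
Qed.

Lemma lam_ptolemy v n (i j k l : 'I_n) : clockwise i j k l ->
  lam v i k != 0 ->
  lam v j l = (lam v i j * lam v k l + lam v j k * lam v l i) / lam v i k.
Proof.
rewrite /clockwise => cw nz; apply: (canRL (mulfK nz)); rewrite mulrC.
case/or4P: cw => /andP[/andP[h1 h2] h3]; first exact: lam_ptolemy_lt.
- by rewrite (lamC v i k) [LHS]mulrC (lam_ptolemy_lt v h1 h2 h3); ring.
- by rewrite (lamC v i k) (lamC v j l) (lam_ptolemy_lt v h1 h2 h3); ring.
- by rewrite (lamC v j l) [LHS]mulrC (lam_ptolemy_lt v h1 h2 h3); ring.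
Qed.

(* By the Ptolemy relations for [n.+1, 0, 1, j], subtracting multiples of rows
   1 and [n.+1] from row 0 leaves only its diagonal entry. *)
Lemma det_lam v n :
  (forall i j, (i < j <= n.+1)%N -> lam v i j != 0) ->
  \det (\matrix_(i < n.+2, j < n.+2) lam v i j)
  = - (-2) ^+ n * (\prod_(i < n.+1) lam v i i.+1 * lam v n.+1 0).
Proof.
elim: n v => [|m IHm] v nz.
  rewrite (expand_det_row _ 0) !big_ord_recl !big_ord0 /cofactor !det_mx11.
  rewrite !mxE /=.
  by rewrite lamii (lamC v 1 0) /=; ring.
set w := fun i => v i.+1.
have wE i j : lam w i j = lam v i.+1 j.+1 by [].
have {IHm} : \det _ = _ := IHm w _.
set A := \matrix_(i, j) _ => IHm.
set x := lam v 1 m.+2.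
have nzx : x != 0 by apply: nz; lia.
pose b := \col_(i < m.+2) lam v i.+1 0.
(* The coefficients that express [lam v 0 j] through [lam v 1 j] and [lam v m.+2 j] for [j > 0]; in
   column 0 the entry differs from this combination by [d]. *)
pose r := \row_(j < m.+2) (lam v 0 m.+2 / x * (j == ord0)%:R
   + lam v 0 1 / x * (j == ord_max)%:R).
pose d := -2 * lam v 0 1 * lam v 0 m.+2 / x.
have rE p (B : 'M[F]_(m.+2, p)) j : (r *m B) 0 j =
    lam v 0 m.+2 / x * B ord0 j + lam v 0 1 / x * B ord_max j.
  rewrite mxE; under eq_bigr => i _ do rewrite mxE mulrDl.
  rewrite big_split /=; congr (_ + _).
    rewrite (bigD1 ord0) //= ?eqxx mulr1 big1 ?addr0 // => i /negPf->.
    by rewrite mulr0 mul0r.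
  rewrite (bigD1 ord_max) //= ?eqxx mulr1 big1 ?addr0 // => i /negPf->.
  by rewrite mulr0 mul0r.
have blockE : \matrix_(i < m.+3, j < m.+3) lam v i j =
   block_mx 1%:M r 0 1%:M *m (block_mx d%:M 0 b A : 'M_(1 + m.+2)).
  rewrite mulmx_block !mul1mx !mul0mx !add0r.
  apply/(@matrixP _ (1 + m.+2) (1 + m.+2))=> i j; rewrite [LHS]mxE.
  case: (split_ordP i) => i' ->;
    case: (split_ordP j) => j' -> /=;
    rewrite ?(block_mxEul, block_mxEur, block_mxEdl, block_mxEdr) ?add1n.
  - rewrite !ord1 lamii mxE rE !mxE /= /d (lamC v 1) (lamC v m.+2 0).
    by rewrite mulr1n -/x; field.
  - rewrite !ord1 rE !mxE /= !wE.
    move: nzx; rewrite /x /lam /= !ltnS.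
    case: (posnP j') => [->|j0] /=.
      by rewrite /det2 => /= nzx; field.
    have [->|jm] : j' = m.+1 :> nat \/ (j' < m.+1)%N by have := ltn_ord j'; lia.
      by rewrite ltnn /det2 => /= nzx; field.
    by rewrite ltnNge (ltnW jm) /det2 => /= nzx; field.
  - by rewrite !ord1 mxE.
  - by rewrite !mxE.
transitivity (@determinant F (1 + m.+2)
    (block_mx 1%:M r 0 1%:M *m block_mx d%:M 0 b A)).
  by rewrite -blockE.
rewrite det_mulmx det_ublock det_lblock !det1 !mul1r det_scalar1.
rewrite IHm => [|i j hij]; last by rewrite wE nz //; lia.
rewrite [in RHS]big_ord_recl /=.
set p := \prod_(i < m.+1) _; rewrite exprS wE.
have -> : p = \prod_(i < m.+1) lam w i i.+1 by apply: eq_bigr.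
(* The closing edge of the smaller polygon is [x]. It cancels the denominator of [d], whose
   numerator supplies the factor -2 and the two edges at the vertex 0. *)
by rewrite /d (lamC v m.+2 1) -/x (lamC v m.+2 0); field.
Qed.
End PlanarDeterminant.
(** * Triangulations *)

Section Crossings.
Variable n : nat.
Implicit Types (a b x y : 'I_n) (d e : {set 'I_n}).

Lemma set2P a b x y : [set a; b] = [set x; y] ->
  (a = x /\ b = y) \/ (a = y /\ b = x).
Proof.
move=> /setP E; move: (E a) (E b) (E x) (E y); rewrite !inE !eqxx !orbT.
case/esym/orP => /eqP ->; case/esym/orP => /eqP ->; auto;
  by move=> /orP[] /eqP ex /orP[] /eqP ey; subst; auto.
Qed.

Lemma clockwise_neq i j k (l : 'I_n) : clockwise i j k l -> i != k.
Proof. by rewrite /clockwise -val_eqE /=; lia. Qed.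

Lemma crossingP a b e : (a < b)%N -> crossing [set a; b] e ->
  exists x y, e = [set x; y] /\ (a < x < b)%N /\ ((y < a)%N || (b < y)%N).
Proof.
move=> ab /existsP[i /existsP[j /existsP[k /existsP[l]]]].
case/and3P=> cw /eqP/set2P E /eqP ->.
case: E => [] [ea eb]; subst i k; move: cw; rewrite /clockwise => cw.
  by exists j, l; split=> //; lia.
by exists l, j; split; [rewrite finset.setUC | lia].
Qed.

Lemma crossing_sym d e : crossing d e -> crossing e d.
Proof.
move=> /existsP[i /existsP[j /existsP[k /existsP[l]]]].
case/and3P=> cw /eqP -> /eqP ->.
apply/existsP; exists j; apply/existsP; exists k; apply/existsP; exists l.
apply/existsP; exists i; rewrite (finset.setUC [set k]) !eqxx !andbT.
by move: cw; rewrite /clockwise; lia.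
Qed.

Lemma crossing_ord a b x y : (a < x)%N -> (x < b)%N -> (b < y)%N ->
  crossing [set a; b] [set x; y].
Proof.
move=> ax xb bY; apply/existsP; exists a; apply/existsP; exists x.
apply/existsP; exists b; apply/existsP; exists y.
by rewrite !eqxx !andbT /clockwise ax xb bY.
Qed.

Lemma boundaryP a b : (a < b)%N -> [set a; b] \in boundary n ->
  b = a.+1 :> nat \/ (a = 0 :> nat /\ b = n.-1 :> nat).
Proof.
move=> ab /imsetP[i _ /set2P E].
have [iN|iN] : i.+1 = n \/ (i.+1 < n)%N by have := ltn_ord i; lia.
  have : ordS i = 0 :> nat by rewrite /= iN modnn.
  by case: E ab => [] [-> ->] + e; rewrite e; [lia|right; lia].
have : ordS i = i.+1 :> nat by rewrite /= modn_small.
by case: E ab => [] [-> ->] + e; rewrite e; [left|lia].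
Qed.

End Crossings.

(** * Edges and triangles of a triangulation *)

Section Triangulations.
Variables (n : nat) (P : {set {set 'I_n}}).
Hypothesis tP : triangulation P.
Implicit Types (a b c x y : 'I_n) (d e : {set 'I_n}).

Definition initial a b := [set a; b] \in initial_edges P.

Lemma initialC a b : initial a b = initial b a.
Proof. by rewrite /initial finset.setUC. Qed.

Lemma initialS a b : b = a.+1 :> nat -> initial a b.
Proof.
move=> e; rewrite /initial inE; apply/orP; right; apply/imsetP; exists a => //.
by congr [set _; _]; apply/val_inj; rewrite /= modn_small -e.
Qed.

Lemma initial_ends a b : a = 0 :> nat -> b = n.-1 :> nat -> initial a b.
Proof.
move=> a0 bn; rewrite initialC /initial inE; apply/orP; right; apply/imsetP.
exists b => //; congr [set _; _]; apply/val_inj => /=.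
by rewrite bn prednK ?modnn ?a0 //; have := ltn_ord a; lia.
Qed.

Let ncP : noncrossing P. Proof. by have /maxsetP[] := tP. Qed.

(** Sides of the polygon cross nothing, so two crossing initial edges would be crossing diagonals of
    [P]. *)
Lemma initial_noncrossing a b x y : (a < x)%N -> (x < b)%N -> (b < y)%N ->
  initial a b -> ~~ initial x y.
Proof.
move=> ax xb bY ab; apply/negP => xy.
have nb (u v : 'I_n) : (u < v)%N -> initial u v -> v <> u.+1 :> nat ->
    ~ (u = 0 :> nat /\ v = n.-1 :> nat) -> [set u; v] \in P.
  by move=> uv; rewrite /initial inE => /orP[//|/(boundaryP uv)[]].
have [_ nc] := andP ncP.
have abP : [set a; b] \in P.
  by apply: nb ab _ _; have := ltn_ord y; lia.
have xyP : [set x; y] \in P by apply: nb xy _ _; lia.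
have /forall_inP/(_ _ xyP)/negP := forall_inP nc _ abP.
by apply; apply: crossing_ord.
Qed.

(** By maximality of [P]: if no diagonal of [P] crossed it, the edge could be added. *)
Lemma noninitial_crossed a b : (a < b)%N -> ~~ initial a b ->
  exists x y, initial x y /\ (a < x < b)%N /\ ((y < a)%N || (b < y)%N).
Proof.
move=> ab; rewrite /initial inE negb_or => /andP[abP abB].
have dab : Defs.diagonal [set a; b].
  by rewrite /Defs.diagonal abB cards2 andbT neq_ltn ab.
suff [e eP /(crossingP ab)[x [y [E xy]]]] :
    exists2 e, e \in P & crossing [set a; b] e.
  by exists x, y; rewrite /initial inE -E eP.
apply: contrapT => H; move/negP: abP; apply.
have /maxsetP[_ max] := tP.
rewrite -(max ([set a; b] |: P)) ?finset.subsetUr ?setU11 //.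
have [/forall_inP dP /forall_inP nc] := andP ncP.
apply/andP; split.
  by apply/forall_inP => e; rewrite !inE => /predU1P[->|/dP].
apply/forall_inP => d dP'; apply/forall_inP => e eP'; apply/negP => cr.
move: dP' eP' cr; rewrite !inE.
move=> /predU1P[->|d_P] /predU1P[->|e_P] cr.
- have [x [y [/set2P E]]] := crossingP ab cr.
  by case: E => [] [? ?]; subst x y; lia.
- by apply: H; exists e.
- by apply: H; exists d => //; apply: crossing_sym.
- by have /forall_inP/(_ _ e_P)/negP := nc _ d_P.
Qed.

(** The apex is the last vertex before [b] joined to [a]. An initial edge crossing [[set c; b]]
    would cross one of the other two sides of the triangle, or end at [a] against the choice of
    [c]. *)
Lemma initial_apex a b : (a.+1 < b)%N -> initial a b ->
  exists c, [/\ (a < c)%N, (c < b)%N, initial a c & initial c b].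
Proof.
move=> ab iab.
have ha : (a.+1 < n)%N by apply: leq_trans ab (ltnW (ltn_ord b)).
pose Q (x : 'I_n) := [&& (a < x)%N, (x < b)%N & initial a x].
have Q1 : Q (Ordinal ha) by rewrite /Q /= ltnSn ab initialS.
have [c /and3P[ac cb iac] maxc] := arg_maxnP (fun x : 'I_n => val x) Q1.
exists c; split=> //; apply: contraT => /(noninitial_crossed cb).
case=> x [y [xy [/andP[cx xb] yN]]].
have [yb|by_] : (y < c)%N \/ (b < y)%N by case/orP: yN; auto.
  have [ya|ay|ya] := ltngtP y a.
  - have : ~~ initial a b.
      by apply: (@initial_noncrossing y x); rewrite ?(initialC y) //; lia.
    by rewrite iab.
  - have : ~~ initial y x by apply: (@initial_noncrossing a c); rewrite //; lia.
    by rewrite initialC xy.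
  - have : Q x.
      rewrite /Q xb (ltn_trans ac cx) /= initialC.
      by rewrite -(_ : y = a) //; apply: val_inj.
    by move=> /maxc /=; rewrite leqNgt cx.
have : ~~ initial x y by apply: (@initial_noncrossing a b) => //; lia.
by rewrite xy.
Qed.

End Triangulations.
(** * Cluster variables *)

Section PositiveRationalFunctions.
Variables (K : numFieldType) (N : nat).
Implicit Types (p q : {mpoly K[N]}) (f g : {fraction {mpoly K[N]}}).

(** Positivity at the point with all coordinates 1 survives the sums, products and quotients of an
    exchange, so it certifies that all denominators are nonzero. *)
Definition posfrac f : Prop := exists p q,
  [/\ 0 < p.@[fun=> 1], 0 < q.@[fun=> 1] & f = tofrac p / tofrac q].

Lemma tofrac_neq0 p : 0 < p.@[fun=> 1] -> tofrac p != 0.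
Proof. by rewrite tofrac_eq0; apply: contraTneq => ->; rewrite meval0 ltxx. Qed.

Lemma posfrac_neq0 f : posfrac f -> f != 0.
Proof.
by case=> p [q [p0 q0 ->]]; rewrite mulf_neq0 ?invr_eq0 ?tofrac_neq0.
Qed.

Lemma posfracD f g : posfrac f -> posfrac g -> posfrac (f + g).
Proof.
case=> p [q [p0 q0 ->]] [p' [q' [p0' q0' ->]]].
exists (p * q' + p' * q), (q * q'); rewrite mevalD !mevalM.
split; rewrite ?addr_gt0 ?mulr_gt0 //.
by rewrite addf_div ?tofrac_neq0 // tofracD !tofracM.
Qed.

Lemma posfracM f g : posfrac f -> posfrac g -> posfrac (f * g).
Proof.
case=> p [q [p0 q0 ->]] [p' [q' [p0' q0' ->]]].
exists (p * p'), (q * q'); rewrite !mevalM.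
by split; rewrite ?mulr_gt0 // mulf_div !tofracM.
Qed.

Lemma posfrac_div f g : posfrac f -> posfrac g -> posfrac (f / g).
Proof.
move=> pf [p [q [p0 q0 ->]]]; apply: posfracM => //.
by exists q, p; rewrite invf_div.
Qed.

Lemma posfracX i : posfrac (tofrac 'X_i).
Proof.
exists 'X_i, 1; rewrite mevalXU meval1 ltr01; split=> //.
by rewrite tofrac1 divr1.
Qed.
End PositiveRationalFunctions.

(** * Cluster variables as determinants of plane vectors *)

Section ClusterMatrix.
Variables (R : realType) (n : nat) (P : {set {set 'I_n}}).
Hypothesis tP : triangulation P.
Implicit Types (a b c x y : 'I_n).

Local Notation F := (ratfun R P).
Local Notation initial := (initial P).

Lemma initial_var a b : initial a b -> exists e : 'I_#|initial_edges P|,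
  enum_val e = [set a; b].
Proof.
move=> ab.
exists (enum_rank_in (ab : [set a; b] \in initial_edges P) [set a; b]).
exact: enum_rankK_in.
Qed.

Definition positive_value x y (u : F) := posfrac u /\ cluster_value x y u.

Lemma positive_valueC x y u : positive_value x y u -> positive_value y x u.
Proof. by case=> p c; split=> //; apply: ClusterSym. Qed.

Lemma positive_exchange i j k l uij ujk ukl uli uik u : clockwise i j k l ->
  positive_value i j uij -> positive_value j k ujk ->
  positive_value k l ukl -> positive_value l i uli ->
  positive_value i k uik -> u = (uij * ukl + ujk * uli) / uik ->
  positive_value j l u.
Proof.
move=> cw [p1 c1] [p2 c2] [p3 c3] [p4 c4] [p5 c5] ->; split.
  exact: (posfrac_div (posfracD (posfracM p1 p3) (posfracM p2 p4)) p5).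
exact: (ClusterExchange cw c1 c2 c3 c4 c5).
Qed.

Definition initial_value (v : 'I_n -> F * F) x y :=
  forall e, enum_val e = [set x; y] -> ratvar R e = det2 (v x) (v y).

Lemma initial_positive v x y : initial x y -> initial_value v x y ->
  positive_value x y (det2 (v x) (v y)).
Proof.
move=> /initial_var[e Ee] /(_ e Ee) <-.
by split; [apply: posfracX | apply: ClusterInitial].
Qed.

(** Induction on the width of the part cut off by an initial edge: the apex [c] splits it in two,
    the vectors of both parts agree at [c], and exchanges give the chords passing over [c]. *)
Lemma cluster_vectors m a b (va vb : F * F) : (b - a <= m)%N -> (a < b)%N ->
  initial a b ->
  (forall e, enum_val e = [set a; b] -> ratvar R e = det2 va vb) ->
  exists v, [/\ v a = va, v b = vb & forall x y, (a <= x)%N -> (x < y)%N ->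
    (y <= b)%N -> positive_value x y (det2 (v x) (v y)) /\
    (initial x y -> initial_value v x y)].
Proof.
elim: m a b va vb => [|m IHm] a b va vb abm ab iab ini; first by lia.
have [bE|ltab] : b = a.+1 :> nat \/ (a.+1 < b)%N by lia.
  exists (fun x => if x == a then va else vb).
  have ba : (b == a) = false by apply/eqP => e; rewrite e ltnn in ab.
  rewrite eqxx ba; split=> // x y ax xy yb.
  have {ax xy yb}[-> ->] : x = a /\ y = b by split; apply: val_inj => /=; lia.
  suff inab : initial_value (fun x => if x == a then va else vb) a b.
    by split=> //; have := initial_positive iab inab; rewrite eqxx ba.
  by rewrite /initial_value eqxx ba.
have [c [ac cb iac icb]] := initial_apex tP ltab iab.
have [eab Eab] := initial_var iab; have [eac Eac] := initial_var iac.
have [ecb Ecb] := initial_var icb.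
pose uac := ratvar R eac; pose ucb := ratvar R ecb.
have uab0 : det2 va vb != 0.
  by rewrite -(ini _ Eab); apply/posfrac_neq0/posfracX.
pose vc := weighted_sum (det2 va vb) ucb va uac vb.
have dac : det2 va vc = uac by exact: det2_weighted_suml.
have dcb : det2 vc vb = ucb by exact: det2_weighted_sumr.
have inac e : enum_val e = [set a; c] -> ratvar R e = det2 va vc.
  by move=> Ee; rewrite dac; congr ratvar; apply: enum_val_inj; rewrite Ee.
have incb e : enum_val e = [set c; b] -> ratvar R e = det2 vc vb.
  by move=> Ee; rewrite dcb; congr ratvar; apply: enum_val_inj; rewrite Ee.
have [v1 [v1a v1c gv1]] := IHm a c va vc ltac:(lia) ac iac inac.
have [v2 [v2c v2b gv2]] := IHm c b vc vb ltac:(lia) cb icb incb.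
pose v x := if (x <= c)%N then v1 x else v2 x.
have vl x : (x <= c)%N -> v x = v1 x by rewrite /v => ->.
have vr x : (c <= x)%N -> v x = v2 x.
  rewrite /v leq_eqVlt => /predU1P[e|]; last by rewrite ltnNge => /negPf ->.
  by have <- : c = x by [apply: val_inj]; rewrite leqnn v1c v2c.
exists v; split; [by rewrite vl ?v1a // ltnW|by rewrite vr ?v2b // ltnW|].
have gl x y : (a <= x)%N -> (x < y)%N -> (y <= c)%N ->
    positive_value x y (det2 (v x) (v y)).
  move=> ax xy yc; rewrite !vl //; last by lia.
  by have [] := gv1 x y ax xy yc.
have gr x y : (c <= x)%N -> (x < y)%N -> (y <= b)%N ->
    positive_value x y (det2 (v x) (v y)).
  move=> cx xy yb; rewrite !vr //; last by lia.
  by have [] := gv2 x y cx xy yb.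
have gab : initial_value v a b.
  by move=> e Ee; rewrite vl ?vr ?v1a ?v2b ?ini // ltnW.
(* Chords from [a] come first, by the quadrilateral [b], [a], [c], [y]; the other chords over [c]
   use them in the quadrilateral [a], [x], [c], [y]. *)
have gay y : (c < y)%N -> (y <= b)%N -> positive_value a y (det2 (v a) (v y)).
  move=> cy; rewrite leq_eqVlt => /predU1P[e|yb].
    by have -> : y = b by [apply: val_inj]; exact: (initial_positive iab gab).
  have gcb := gr c b (leqnn _) cb (leqnn _).
  apply: positive_exchange (positive_valueC (initial_positive iab gab))
    (gl a c (leqnn _) ac (leqnn _)) (gr c y (leqnn _) cy (ltnW yb))
    (gr y b (ltnW cy) yb (leqnn _)) (positive_valueC gcb)
    (det2_ptolemyC _ _ (posfrac_neq0 gcb.1)).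
  by rewrite /clockwise; lia.
move=> x y ax xy yb.
have [yc|cy] := leqP y c.
  split; first exact: gl.
  have [_ h ixy e Ee] := gv1 x y ax xy yc.
  by rewrite !vl ?h //; lia.
have [cx|xc] := leqP c x.
  split; first exact: gr.
  have [_ h ixy e Ee] := gv2 x y cx xy yb.
  by rewrite !vr ?h //; lia.
have [xa|{}ax] : x = a \/ (a < x)%N.
- move: ax; rewrite leq_eqVlt => /predU1P[e|]; last by right.
  by left; apply: val_inj.
- subst x; split; first exact: gay.
  move: yb; rewrite leq_eqVlt => /predU1P[e _|yb iay].
    by have -> : y = b by apply: val_inj.
  have : ~~ initial c b by apply: (initial_noncrossing tP ac cy yb iay).
  by rewrite icb.
split; last first.
  have : ~~ initial x y by apply: (initial_noncrossing tP ax xc cy iac).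
  by move=> /negP h /h.
have gac := gl a c (leqnn _) ac (leqnn _).
apply: positive_exchange (gl a x (leqnn _) ax (ltnW xc))
  (gl x c (ltnW ax) xc (leqnn _)) (gr c y (leqnn _) cy yb)
  (positive_valueC (gay y cy yb)) gac
  (det2_ptolemy _ _ (posfrac_neq0 gac.1)).
by rewrite /clockwise; lia.
Qed.

Lemma initial_edge_neq x y : (1 < n)%N -> initial x y -> x != y.
Proof.
move=> n1; rewrite /initial inE => /orP[xyP|/imsetP[i _ E]].
  have /maxsetP[/andP[/forall_inP/(_ _ xyP) /andP[+ _] _] _] := tP.
  by rewrite cards2; case: (x != y).
have : #|[set x; y]| = 2 by rewrite E cards2 eq_sym ordS_neq.
by rewrite cards2; case: (x != y).
Qed.

(** The vectors start from the side joining the first and the last vertex, with [(1, 0)] and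
    [(0, u)] of determinant [u]. *)
Lemma cluster_matrixE : (1 < n)%N -> exists v : nat -> F * F,
  (forall x y, x != y -> lam v x y != 0) /\
  cluster_matrix R P = \matrix_(i, j) lam v i j.
Proof.
move=> n1; have n0 := ltnW n1.
have n'n : (n.-1 < n)%N by lia.
pose a := Ordinal n0; pose b := Ordinal n'n.
have ab : (a < b)%N by rewrite /=; lia.
have iab : initial a b by exact: initial_ends.
have [e Ee] := initial_var iab.
have [||v [_ _ vP]] := @cluster_vectors n a b (1, 0) (0, ratvar R e) _ ab iab.
- by rewrite /= subn0 leq_pred.
- move=> e' Ee'; rewrite /det2 /= mul0r subr0 mul1r; congr ratvar.
  by apply: enum_val_inj; rewrite Ee.
(* The vectors are extended by [(0, 0)] beyond the last vertex. *)
pose vn m := if insub m is Some x then v x else (0, 0).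
have vnE x : vn (val x) = v x by rewrite /vn valK.
have {}vP x y : (x < y)%N -> positive_value x y (lam vn x y) /\
    (forall e, enum_val e = [set x; y] -> ratvar R e = lam vn x y).
  move=> xy; rewrite /lam xy !vnE.
  have yb : (y <= b)%N by have := ltn_ord y; rewrite /=; lia.
  have [pxy ixy] := vP x y (leq0n _) xy yb.
  split=> // e' Ee'; apply: ixy => //.
  by rewrite /initial -Ee' enum_valP.
have pos x y : x != y -> positive_value x y (lam vn x y).
  rewrite neq_ltn => /orP[/vP[]//|/vP[/positive_valueC]].
  by rewrite lamC.
exists vn; split=> [x y /pos[/posfrac_neq0]//|].
(* Uniqueness: each exchange preserves equality with [lam], by the Ptolemy relation with nonzero
   denominator. *)
have val x y u : cluster_value x y u -> u = lam vn x y.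
  elim=> {x y u} [e' x y Ee'|x y u _ ->|i j k l uij ujk ukl uli uik cw
    _ -> _ -> _ -> _ -> _ ->].
  - have : initial x y by rewrite /initial -Ee' enum_valP.
    move/(initial_edge_neq n1); rewrite neq_ltn => /orP[/vP[_ ->]//|/vP[_ E]].
    by rewrite lamC; apply: E; rewrite Ee' finset.setUC.
  - exact: lamC.
  - rewrite -(lam_ptolemy cw) //; apply/posfrac_neq0.
    by have [] := pos i k (clockwise_neq cw).
apply/matrixP => i j; rewrite !mxE; case: eqVneq => [->|ij].
  by rewrite lamii.
case: xgetP => [u _ /val//|/(_ (lam vn i j))].
by case; case: (pos i j ij).
Qed.
End ClusterMatrix.
(** * Frames *)

Section RootCategory.
Variables (k : fieldType) (m : nat).
Local Notation Q := (linear_quiver m).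
Local Notation interval := (interval_rep k m).
Local Notation complex := (bcomplex k Q).
Implicit Types (X Y : complex) (p q s : int) (i j : nat).

(** A single roof in component [s], with zero elsewhere, has finite support and so is a morphism of
    the orbit category. *)
Lemma root_hom_is_zeroP X Y :
  root_hom_is_zero X Y <-> forall s, derived_zero X (shift (s *+ 2) Y).
Proof.
split=> [zero s r|zero f s]; last exact: zero.
pose c t := @dfwith _ (fun t => roof X (shift (t *+ 2) Y))
  (fun t => roof0 X (shift (t *+ 2) Y)) s r t.
have fin : exists N : nat, forall t, (N < `|t|)%N ->
    roof_eq (c t) (roof0 X (shift (t *+ 2) Y)).
  exists `|s|%N => t st; rewrite /c dfwith_out; first exact: roof_eq_refl.
  by apply: contraTneq st => ->; rewrite ltnn.
by have := zero (RootHom fin) s; rewrite /= /c dfwith_in.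
Qed.

Definition hom_cond i j i' j' := (i <= i' < j)%N && (j <= j')%N.

Definition ext_cond i j i' j' := (i' < i)%N && (i <= j' < j)%N.

Section Intervals.
Variables (X Y : complex) (p q : int) (i j i' j' : nat).
Hypotheses (ij : (i < j <= m)%N) (ij' : (i' < j' <= m)%N).
Hypotheses (cX : concentrated X p (interval i j))
  (cY : concentrated Y q (interval i' j')).

(** Parity decides: even shifts can bring [Y] to degree [p] but never to [p - 1], so only Hom
    remains. In the odd case only Ext does. *)
Lemma root_hom_even s : q = p + s *+ 2 ->
  root_hom_is_zero X Y <-> ~~ hom_cond i j i' j'.
Proof.
move=> e; split=> [/root_hom_is_zeroP zero|nhom].
  apply/negP => hom; apply: (derived_hom_nonzero ij ij' cX _ hom) (zero s).
  by rewrite (_ : p = q - s *+ 2); [apply: concentrated_shift|rewrite e addrK].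
apply/root_hom_is_zeroP => t.
apply: (derived_zero_interval ij ij' cX (concentrated_shift (t *+ 2) cY)).
  by rewrite negb_and nhom orbT.
by rewrite negb_and; apply/orP; left; apply/eqP; rewrite e; lia.
Qed.

Lemma root_hom_odd s : q = p - 1 + s *+ 2 ->
  root_hom_is_zero X Y <-> ~~ ext_cond i j i' j'.
Proof.
move=> e; split=> [/root_hom_is_zeroP zero|next].
  apply/negP => ext; apply: (derived_ext_nonzero ij ij' _ cX _ ext) (zero s).
    exact: erefl.
  rewrite (_ : p - 1 = q - s *+ 2); first exact: concentrated_shift.
  by rewrite e addrK.
apply/root_hom_is_zeroP => t.
apply: (derived_zero_interval ij ij' cX (concentrated_shift (t *+ 2) cY)).
  by rewrite negb_and; apply/orP; left; apply/eqP; rewrite e; lia.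
by rewrite negb_and next orbT.
Qed.
End Intervals.
End RootCategory.

(** * Frames of oriented edges *)

Section EdgeFrames.
Variables (k : fieldType) (n : nat).
Implicit Types X Y : 'I_n * 'I_n.
Local Notation M := (@edge_object k n).

Let lo X := minn X.1 X.2.
Let hi X := maxn X.1 X.2.
(** The shift [[1]] moves a module from degree 0 to degree -1. *)
Let degree X : int := if (X.1 < X.2)%N then 0 else -1.

Lemma concentrated_edge X :
  concentrated (M X) (degree X) (interval_rep k n.-1 (lo X) (hi X)).
Proof.
rewrite /edge_object /degree /lo /hi; case: ltnP => X12.
  exact: concentrated_stalk.
rewrite -sub0r; exact/concentrated_shift/concentrated_stalk.
Qed.

Lemma edge_bounds X : X \in oriented_edges n -> (lo X < hi X <= n.-1)%N.
Proof.
rewrite inE -val_eqE /lo /hi /=; have := ltn_ord X.1; have := ltn_ord X.2; lia.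
Qed.

Definition edge_hom X Y : bool :=
  (if (X.1 < X.2)%N == (Y.1 < Y.2)%N then hom_cond else ext_cond)
    (lo X) (hi X) (lo Y) (hi Y).

Definition edge_ext X Y : bool :=
  (if (X.1 < X.2)%N == (Y.1 < Y.2)%N then ext_cond else hom_cond)
    (lo X) (hi X) (lo Y) (hi Y).

Lemma edge_homP X Y : X \in oriented_edges n -> Y \in oriented_edges n ->
  root_hom_is_zero (M X) (M Y) <-> ~~ edge_hom X Y.
Proof.
move=> /edge_bounds bX /edge_bounds bY; rewrite /edge_hom.
have [cX cY] := (concentrated_edge X, concentrated_edge Y).
move: cX cY; rewrite /degree; case: (X.1 < X.2)%N; case: (Y.1 < Y.2)%N => cX cY.
- exact: (root_hom_even bX bY cX cY (s := 0)).
- exact: (root_hom_odd bX bY cX cY (s := 0)).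
(* Here [M Y] lies one degree above [M X]; the shift by 2 brings it one degree below. *)
- exact: (root_hom_odd bX bY cX cY (s := 1)).
- exact: (root_hom_even bX bY cX cY (s := 0)).
Qed.

Lemma edge_extP X Y : X \in oriented_edges n -> Y \in oriented_edges n ->
  root_ext1_is_zero (M X) (M Y) <-> ~~ edge_ext X Y.
Proof.
move=> /edge_bounds bX /edge_bounds bY; rewrite /edge_ext /root_ext1_is_zero.
have cX := concentrated_edge X.
have cY := concentrated_shift 1 (concentrated_edge Y).
move: cX cY; rewrite /degree; case: (X.1 < X.2)%N; case: (Y.1 < Y.2)%N => cX cY.
- exact: (root_hom_odd bX bY cX cY (s := 0)).
- exact: (root_hom_even bX bY cX cY (s := -1)).
- exact: (root_hom_even bX bY cX cY (s := 0)).
- exact: (root_hom_odd bX bY cX cY (s := 0)).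
Qed.

(** Both frames become inequalities between the four end-points, settled by arithmetic for each pair
    of orientations. *)
Lemma frameP X Y : X \in oriented_edges n -> Y \in oriented_edges n ->
  frame k X Y <-> X.1 = Y.1 \/ X.2 = Y.2.
Proof.
move=> hX hY; rewrite /frame /starting_frame /ending_frame.
rewrite !edge_homP // !edge_extP //.
have -> : (X.1 = Y.1 \/ X.2 = Y.2) <->
    (X.1 = Y.1 :> nat \/ X.2 = Y.2 :> nat).
  by split=> -[e|e]; rewrite ?e; auto; [left|right]; apply: val_inj.
move: hX hY; rewrite !inE -!val_eqE /edge_hom /edge_ext /hom_cond /ext_cond.
rewrite /lo /hi /=; case: X Y => [a b] [c d] /= ab cd.
case: (ltnP a b) => h1; case: (ltnP c d) => h2 /=; lia.
Qed.
End EdgeFrames.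

(** * The signed sum as the determinant of the cluster matrix *)

Theorem theorem8p4 (R : realType) (k : closedFieldType) (n : nat)
    (hn : (3 <= n)%N) (P : {set {set 'I_n}}) (hP : triangulation P) :
  let U := cluster_matrix R P in
  \sum_(C : {set 'I_n * 'I_n} | `[< maximum_configuration k C >])
     (config_sign C)%:~R * config_weight U C
  = - (-2) ^+ (n - 2) * \prod_(i < n) U i (ordS i).
Proof.
move=> U; rewrite (sum_maximum_configuration (ltnW hn) (@frameP k n));
  last by move=> i; rewrite mxE eqxx.
have [v [nz UE]] := cluster_matrixE R hP (ltnW hn).
rewrite /U {U}UE; case: n hn P hP v nz => [|[|m]] // hn P hP v nz.
rewrite det_lam => [|i j ij]; last first.
  have hi : (i < m.+2)%N by lia.
  have hj : (j < m.+2)%N by lia.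
  by apply: (nz (Ordinal hi) (Ordinal hj)); rewrite -val_eqE /=; lia.
(* The last factor of the cyclic product is the side from the last vertex back to 0. *)
rewrite !subSS subn0 [in RHS]big_ord_recr /=; congr (_ * (_ * _)).
  apply: eq_bigr => i _; rewrite mxE; congr lam; rewrite /= modn_small //.
  by have := ltn_ord i; lia.
by rewrite mxE /= modnn.
Qed.
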